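(* Let $W$ be a complex vector space of dimension $\mathbf{w}\ge 1$ and let $d,\delta$ be positive integers such that $$d\ \ge\ (\delta-1)(\mathbf{w}-1)\left((\delta-1)\left\lceil\frac{\binom{\delta+\mathbf{w}-1}{\mathbf{w}-1}}{\mathbf{w}}\right\rceil+\delta\right).$$ Then the Foulkes-Howe map $\mathcal{F}^{\delta}_{(1)^d}:S^\delta(S^dW)\to S^d(S^\delta W)$ is injective.
   Context: The Foulkes-Howe map $\mathcal{F}^{\delta}_{(1)^d}:S^\delta(S^dW)\to S^d(S^\delta W)$ is defined as follows: include $S^\delta(S^dW)\subset W^{\otimes\delta d}$ and label the tensor factors $(W_{1,1}\otimes\cdots\otimes W_{1,d})\otimes\cdots\otimes(W_{\delta,1}\otimes\cdots\otimes W_{\delta,d})$, all $W_{i,j}$ being copies of $W$; regroup as $(W_{1,1}\otimes\cdots\otimes W_{\delta,1})\otimes\cdots\otimes(W_{1,d}\otimes\cdots\otimes W_{\delta,d})$; symmetrize each of the $d$ groups of $\delta$ factors, and then symmetrize the ordering of the $d$ groups, to get an element of $S^d(S^\delta W)$. *)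

(* Defs.v *)
From HB Require Import structures.
From mathcomp Require Export all_boot all_order all_algebra all_fingroup.
From mathcomp Require Export reals complex.

Set Implicit Arguments.
Unset Strict Implicit.
Unset Printing Implicit Defensive.

Import GRing.Theory Num.Theory.
Local Open Scope ring_scope.

Section TensorPower.
Variable K : fieldType.
Implicit Types (I J : finType) (U V : vectType K).

(* V^{\otimes I}, by coordinates on the tensors of the vectors of the fixed
   basis [vbasis {:V}]. Its universal property is [tlift_tprod] (existence)
   and [tprod_ext] (uniqueness). The factors are labelled by an arbitrary
   finite type I, so that double indices W_{i,j} need no encoding. *)
Definition tpow I V : vectType K :=
  {ffun {ffun I -> 'I_(\dim {:V})} -> K^o}.

Definition tcoef I V (t : tpow I V) (f : {ffun I -> 'I_(\dim {:V})}) : K :=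
  (t : {ffun {ffun I -> 'I_(\dim {:V})} -> K^o}) f.

(* \bigotimes_i v i *)
Definition tprod I V (v : {ffun I -> V}) : tpow I V :=
  [ffun f : {ffun I -> 'I_(\dim {:V})} =>
     \prod_i coord (vbasis {:V}) (f i) (v i) : K^o].

Definition tbasis I V (f : {ffun I -> 'I_(\dim {:V})}) : {ffun I -> V} :=
  [ffun i => (vbasis {:V})`_(f i)].

Definition upd I V (v : {ffun I -> V}) (i : I) (x : V) : {ffun I -> V} :=
  [ffun j => if j == i then x else v j].

Definition multilinear I V U (M : {ffun I -> V} -> U) : Prop :=
  forall v i, linear (fun x => M (upd v i x)).

(* The linear map V^{\otimes I} -> U with tprod v |-> M v, for M multilinear. *)
Definition tlift I V U (M : {ffun I -> V} -> U) (t : tpow I V) : U :=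
  \sum_f tcoef t f *: M (tbasis f).

Fact tlift_is_linear I V U (M : {ffun I -> V} -> U) : linear (tlift M).
Proof.
move=> a s t; rewrite /tlift scaler_sumr -big_split; apply: eq_bigr => f _ /=.
by rewrite /tcoef !ffunE scalerDl scalerA.
Qed.

HB.instance Definition _ I V U (M : {ffun I -> V} -> U) :=
  GRing.isLinear.Build K (tpow I V) U _ (tlift M) (tlift_is_linear M).

Lemma upd_id I V (v : {ffun I -> V}) i : upd v i (v i) = v.
Proof. by apply/ffunP => j; rewrite ffunE; case: eqP => [->|]. Qed.

Lemma tprod_multilinear I V : multilinear (@tprod I V).
Proof.
move=> v i a x y; apply/ffunP => f.
rewrite !ffunE (bigD1 i) //= [X in _ = _ *: X + _](bigD1 i) //=.
rewrite [X in _ = _ + X](bigD1 i) //= !ffunE eqxx linearP /=.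
have E z : \prod_(j | j != i) coord (vbasis {:V}) (f j) (upd v i z j) =
           \prod_(j | j != i) coord (vbasis {:V}) (f j) (v j).
  by apply: eq_bigr => j /negbTE ji; rewrite ffunE ji.
by rewrite !E mulrDl -mulrA.
Qed.

Lemma tcoef_tprod_basis I V (f g : {ffun I -> 'I_(\dim {:V})}) :
  tcoef (tprod (tbasis f)) g = (f == g)%:R.
Proof.
rewrite /tcoef ffunE; have [->|/eqP nfg] := eqVneq f g.
  rewrite big1 // => i _; rewrite ffunE coord_free ?eqxx //.
  exact: basis_free (vbasisP _).
have [i /negbTE nfgi] : exists i, f i != g i.
  apply/existsP; apply: contra_notT nfg => /existsPn fg.
  by apply/ffunP => i; apply/eqP; rewrite -[_ == _]negbK fg.
rewrite (bigD1 i) //= ffunE coord_free ?(basis_free (vbasisP _)) //.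
by rewrite nfgi mul0r.
Qed.

Lemma tlift_tprod_basis I V U (M : {ffun I -> V} -> U) f :
  tlift M (tprod (tbasis f)) = M (tbasis f).
Proof.
rewrite /tlift (bigD1 f) //= tcoef_tprod_basis eqxx scale1r big1 ?addr0 //.
by move=> g gf; rewrite tcoef_tprod_basis eq_sym (negbTE gf) scale0r.
Qed.

Lemma multilinear_ext I V U (M N : {ffun I -> V} -> U) :
    multilinear M -> multilinear N ->
    (forall f, M (tbasis f) = N (tbasis f)) -> M =1 N.
Proof.
move=> linM linN eqMN v.
suff {v} H (s : seq I) (v : {ffun I -> V}) : (forall i, i \notin s ->
    exists k : 'I_(\dim {:V}), v i = (vbasis {:V})`_k) -> M v = N v.
  by apply: (H (enum I)) => i; rewrite mem_enum.
elim: s v => [|i s IHs] v vs.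
  have /fin_all_exists[f vf] i : exists k : 'I_(\dim {:V}), v i = (vbasis {:V})`_k.
    exact: vs.
  have -> : v = tbasis (finfun f) by apply/ffunP => i; rewrite !ffunE vf.
  exact: eqMN.
have sum_upd (P : {ffun I -> V} -> U) : multilinear P -> P v =
  \sum_(k < \dim {:V}) coord (vbasis {:V}) k (v i) *: P (upd v i (vbasis {:V})`_k).
  move=> linP; pose p := GRing.isLinear.Build _ _ _ _ _ (linP v i).
  pose L : {linear V -> U} := HB.pack (fun x => P (upd v i x)) p.
  rewrite -{1}(upd_id v i) -[LHS]/(L (v i)).
  rewrite {1}(coord_vbasis (memvf (v i))) linear_sum; apply: eq_bigr => k _.
  by rewrite linearZ.
rewrite (sum_upd M) // (sum_upd N) //; apply: eq_bigr => k _; congr (_ *: _).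
apply: IHs => j js; rewrite ffunE; case: eqP => [_|/eqP ji]; first by exists k.
by apply: vs; rewrite inE negb_or ji.
Qed.

Lemma multilinear_comp I V U U' (M : {ffun I -> V} -> U) (L : {linear U -> U'}) :
  multilinear M -> multilinear (L \o M).
Proof. by move=> linM v i a x y; rewrite /= linM linearP. Qed.

Lemma tlift_tprod I V U (M : {ffun I -> V} -> U) :
  multilinear M -> forall v, tlift M (tprod v) = M v.
Proof.
move=> linM; apply: (@multilinear_ext _ _ _ (tlift M \o @tprod I V)) => //.
- exact/multilinear_comp/tprod_multilinear.
- exact: tlift_tprod_basis.
Qed.

Lemma tprod_ext I V U (L L' : {linear tpow I V -> U}) :
  (forall v, L (tprod v) = L' (tprod v)) -> L =1 L'.
Proof.
move=> eqL t; suff -> : t = \sum_f tcoef t f *: tprod (tbasis f).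
  by rewrite !linear_sum; apply: eq_bigr => f _; rewrite !linearZ /= eqL.
apply/ffunP => g; rewrite sum_ffunE (bigD1 g) //= ffunE.
rewrite -[tprod _ _]/(tcoef _ g) tcoef_tprod_basis eqxx big1 ?addr0.
  by rewrite /GRing.scale /= mulr1.
move=> f fg; rewrite ffunE -[tprod _ _]/(tcoef _ g) tcoef_tprod_basis.
by rewrite (negbTE fg) scaler0.
Qed.

(* f^{\otimes I} : V^{\otimes I} -> U^{\otimes I}, for f linear *)
Definition tmap I V U (f : V -> U) : tpow I V -> tpow I U :=
  tlift (fun v : {ffun I -> V} => tprod [ffun i => f (v i)]).

(* \bigotimes_i v i |-> \bigotimes_i v (s i) *)
Definition tact I V (s : {perm I}) : tpow I V -> tpow I V :=
  tlift (fun v : {ffun I -> V} => tprod [ffun i => v (s i)]).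

(* The canonical isomorphism (V^{\otimes J})^{\otimes I} ~ V^{\otimes (I x J)},
   \bigotimes_i \bigotimes_j v i j |-> \bigotimes_(i, j) v i j. *)
Definition tflatten I J V : tpow I (tpow J V) -> tpow (I * J)%type V :=
  tlift (fun t : {ffun I -> tpow J V} =>
    [ffun g : {ffun I * J -> 'I_(\dim {:V})} =>
       \prod_i tcoef (t i) [ffun j => g (i, j)] : K^o] : tpow (I * J)%type V).

(* \bigotimes_(i, j) v i j |-> \bigotimes_j \bigotimes_i v i j *)
Definition tregroup I J V : tpow (I * J)%type V -> tpow J (tpow I V) :=
  tlift (fun v : {ffun I * J -> V} =>
    tprod [ffun j => tprod [ffun i => v (i, j)]]).

HB.instance Definition _ I V U (f : V -> U) :=
  GRing.Linear.copy (@tmap I V U f) (tlift _).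
HB.instance Definition _ I V (s : {perm I}) :=
  GRing.Linear.copy (@tact I V s) (tlift _).
HB.instance Definition _ I J V :=
  GRing.Linear.copy (@tflatten I J V) (tlift _).
HB.instance Definition _ I J V :=
  GRing.Linear.copy (@tregroup I J V) (tlift _).

Lemma tmap_tprod I V U (f : {linear V -> U}) (v : {ffun I -> V}) :
  tmap f (tprod v) = tprod [ffun i => f (v i)].
Proof.
rewrite /tmap tlift_tprod // => {}v i a x y.
have E z : [ffun j => f (upd v i z j)] = upd [ffun j => f (v j)] i (f z).
  by apply/ffunP => j; rewrite !ffunE; case: eqP.
by rewrite !E linearP tprod_multilinear.
Qed.

Lemma tact_tprod I V (s : {perm I}) (v : {ffun I -> V}) :
  tact s (tprod v) = tprod [ffun i => v (s i)].
Proof.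
rewrite /tact tlift_tprod // => {}v i a x y.
have E z : [ffun j => upd v i z (s j)] = upd [ffun j => v (s j)] (s^-1 i)%g z.
  by apply/ffunP => j; rewrite !ffunE (canF_eq (permK s)).
by rewrite !E tprod_multilinear.
Qed.

Lemma tflatten_tprod I J V (v : {ffun I -> {ffun J -> V}}) :
  tflatten (tprod [ffun i => tprod (v i)]) =
  tprod [ffun ij : I * J => v ij.1 ij.2].
Proof.
rewrite /tflatten tlift_tprod.
  apply/ffunP => g; rewrite !ffunE.
  under eq_bigr do rewrite /tcoef !ffunE.
  rewrite pair_big; apply: eq_bigr => -[i j] _ /=.
  by rewrite !ffunE.
move=> {}v i a x y; apply/ffunP => g.
rewrite !ffunE (bigD1 i) //= [X in _ = _ *: X + _](bigD1 i) //=.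
rewrite [X in _ = _ + X](bigD1 i) //= /tcoef !ffunE eqxx.
have E z : \prod_(k | k != i) tcoef (upd v i z k) [ffun j => g (k, j)] =
           \prod_(k | k != i) tcoef (v k) [ffun j => g (k, j)].
  by apply: eq_bigr => j /negbTE ji; rewrite ffunE ji.
by rewrite !E !ffunE mulrDl -mulrA.
Qed.

Lemma tregroup_tprod I J V (v : {ffun I * J -> V}) :
  tregroup (tprod v) = tprod [ffun j => tprod [ffun i => v (i, j)]].
Proof.
rewrite /tregroup tlift_tprod // => {}v [i j] a x y.
pose w := [ffun l => tprod [ffun k => v (k, l)]].
have E z : [ffun l => tprod [ffun k => upd v (i, j) z (k, l)]] =
           upd w j (tprod (upd [ffun k => v (k, j)] i z)).
  apply/ffunP => l; rewrite !ffunE; have [->|nlj] := eqVneq l j.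
    by congr tprod; apply/ffunP => k; rewrite !ffunE xpair_eqE eqxx andbT.
  congr tprod; apply/ffunP => k.
  by rewrite !ffunE xpair_eqE (negbTE nlj) andbF.
by rewrite !E tprod_multilinear tprod_multilinear.
Qed.

End TensorPower.

Section SymmetricPower.
Variable K : numFieldType.
Implicit Types V W : vectType K.

(* S^n V as the subspace of symmetric tensors of V^{\otimes n}. *)
Definition symspace n V : {vspace tpow 'I_n V} :=
  \bigcap_(s : 'S_n) fixedSpace (linfun (@tact K 'I_n V s)).

Definition sympow n V : vectType K := subvs_of (symspace n V).

Definition symmetrize n V (t : tpow 'I_n V) : tpow 'I_n V :=
  (n`!%:R)^-1 *: \sum_(s : 'S_n) tact s t.

Lemma mem_symspace n V (t : tpow 'I_n V) :
  reflect (forall s : 'S_n, tact s t = t) (t \in symspace n V).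
Proof.
apply: (iffP idP) => [|tK].
  by rewrite memvE => /subv_bigcapP tS s; have := tS s isT;
    rewrite -memvE => /fixedSpaceP; rewrite lfunE.
rewrite memvE; apply/subv_bigcapP => s _; rewrite -memvE.
by apply/fixedSpaceP; rewrite lfunE /= tK.
Qed.

Lemma tactM n V (s r : 'S_n) (t : tpow 'I_n V) :
  tact s (tact r t) = tact (s * r)%g t.
Proof.
rewrite -[LHS]/((tact s \o tact r) t); apply: tprod_ext => v /=.
by rewrite !tact_tprod; congr tprod; apply/ffunP => i; rewrite !ffunE permM.
Qed.

Lemma symmetrize_mem n V (t : tpow 'I_n V) : symmetrize t \in symspace n V.
Proof.
apply/mem_symspace => s; rewrite linearZ linear_sum /=; congr (_ *: _).
rewrite [RHS](reindex_inj (mulgI s)); apply: eq_bigr => r _.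
by rewrite tactM.
Qed.

Lemma symmetrize_id n V (t : tpow 'I_n V) :
  t \in symspace n V -> symmetrize t = t.
Proof.
move=> /mem_symspace tK; rewrite /symmetrize.
under eq_bigr do rewrite tK.
rewrite sumr_const card_Sn -scaler_nat scalerA mulVf ?scale1r //.
by rewrite pnatr_eq0 -lt0n fact_gt0.
Qed.

(* The symmetrization projection V^{\otimes n} -> S^n V; by [symmetrize_mem],
   vsproj here only recasts its argument to the subspace type. *)
Definition symproj n V (t : tpow 'I_n V) : sympow n V :=
  vsproj (symspace n V) (symmetrize t).

Lemma vsval_symproj n V (t : tpow 'I_n V) : vsval (symproj t) = symmetrize t.
Proof. exact/vsprojK/symmetrize_mem. Qed.

Fact symproj_is_linear n V : linear (@symproj n V).
Proof.
move=> a s t; rewrite /symproj -linearP; congr (vsproj _ _).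
rewrite /symmetrize scalerA mulrC -scalerA -scalerDr; congr (_ *: _).
rewrite scaler_sumr -big_split; apply: eq_bigr => r _ /=.
by rewrite linearP.
Qed.

HB.instance Definition _ n V :=
  GRing.isLinear.Build K (tpow 'I_n V) (sympow n V) _ (@symproj n V)
    (@symproj_is_linear n V).

(* S^n(S^d W) -> W^{\otimes (n x d)} *)
Definition sympow_incl n d W (x : sympow n (sympow d W)) :
    tpow ('I_n * 'I_d)%type W :=
  tflatten (tmap (vsval : sympow d W -> tpow 'I_d W) (vsval x)).

(* S^n(S^d W) -> S^d(S^n W) *)
Definition foulkes_howe n d W (x : sympow n (sympow d W)) :
    sympow d (sympow n W) :=
  symproj (tmap (@symproj n W) (tregroup (sympow_incl x))).

Fact foulkes_howe_is_linear n d W : linear (@foulkes_howe n d W).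
Proof. by move=> a x y; rewrite /foulkes_howe /sympow_incl !linearP. Qed.

HB.instance Definition _ n d W :=
  GRing.isLinear.Build K (sympow n (sympow d W)) (sympow d (sympow n W)) _
    (@foulkes_howe n d W) (@foulkes_howe_is_linear n d W).

Lemma symproj_const n V (x : V) :
  vsval (symproj (tprod [ffun=> x] : tpow 'I_n V)) = tprod [ffun=> x].
Proof.
rewrite vsval_symproj symmetrize_id //; apply/mem_symspace => s.
by rewrite tact_tprod; congr tprod; apply/ffunP => i; rewrite !ffunE.
Qed.

Lemma symproj_act n V (s : 'S_n) (t : tpow 'I_n V) :
  symproj (tact s t) = symproj t.
Proof.
congr (vsproj _ _); congr (_ *: _); rewrite [RHS](reindex_inj (mulIg s)).
by apply: eq_bigr => r _; rewrite tactM.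
Qed.

(* x_1^d ... x_n^d |-> (x_1 ... x_n)^d; such elements span S^n(S^d W). *)
Lemma foulkes_howe_powers n d W (x : {ffun 'I_n -> W}) :
  foulkes_howe (symproj (tprod [ffun i => symproj (tprod [ffun=> x i])])) =
  symproj (tprod [ffun=> symproj (tprod x)]) :> sympow d (sympow n W).
Proof.
rewrite /foulkes_howe /sympow_incl vsval_symproj /symmetrize.
pose F : {linear tpow 'I_n (sympow d W) -> sympow d (sympow n W)} :=
  @symproj d (sympow n W) \o tmap (@symproj n W) \o @tregroup K _ _ W \o
  @tflatten K 'I_n 'I_d W \o tmap (vsval : sympow d W -> _).
rewrite -[LHS]/(F _) linearZ linear_sum.
under eq_bigr => s _.
  rewrite /F /= tact_tprod tmap_tprod.
  have -> : [ffun i => vsval ([ffun i0 => [ffun i1 =>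
       symproj (tprod [ffun=> x i1] : tpow 'I_d W)] (s i0)] i)] =
     [ffun i => tprod ([ffun k => [ffun=> x (s k)]] i)].
    by apply/ffunP => i; rewrite !ffunE symproj_const.
  rewrite tflatten_tprod tregroup_tprod tmap_tprod.
  have -> : [ffun i => symproj ([ffun j => tprod [ffun i0 =>
      [ffun ij : 'I_n * 'I_d => [ffun k => [ffun=> x (s k)]] ij.1 ij.2]
        (i0, j)]] i)] = [ffun=> symproj (tprod x)].
    apply/ffunP => j; rewrite !ffunE -(symproj_act s (tprod x)) tact_tprod.
    by congr (symproj (tprod _)); apply/ffunP => i; rewrite !ffunE.
  over.
rewrite sumr_const card_Sn /= -scaler_nat scalerA mulVf ?scale1r //.
by rewrite pnatr_eq0 -lt0n fact_gt0.
Qed.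

End SymmetricPower.

(* Main.v *)
Require Import Defs.
From HB Require Import structures.
From mathcomp Require Import boolp zify ring.

Set Implicit Arguments.
Unset Strict Implicit.
Unset Printing Implicit Defensive.

Import Order.TTheory GRing.Theory Num.Theory.
Local Open Scope ring_scope.

(* Write n for delta and w for dim W. By duality, foulkes_howe is injective as
   soon as every symmetric polynomial in n vectors of W, homogeneous of degree d
   in each of them, is a combination of products of d brackets
   br(l_1, ..., l_n) = sum_s prod_i l_(s i)(x_i) of linear forms. Let A_d be the
   space of the former and B_d that of the latter, and write N(l) for
   prod_i l(x_i).

   - Binary forms split into linear factors and N is multiplicative, so that
     A_d = B_d in two variables; by polarization A_d is spanned by the brackets of
     d-th powers l_i^d, so that one may assume w <= n.
   - If any w of the forms l_j are independent and there are r = n(w-1)+1 of them,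
     then A_m is the sum of the N(l_j) A_(m-1) for m > (n-1)(w-1). A variant in
     w-1 variables, for components of unequal degrees, gives A_m = A_1 A_(m-1)
     for m > (n-1)(w-2).
   - N(l)^c A_m is contained in B_(c+m) for c >= (n-1)m, since a multisymmetric
     function of total degree k is a polynomial of degree k in the brackets;
     hence, for c = (n-1)^2(w-2), N(l)^c A_m is contained in B_(c+m) for all m.
   - By the pigeonhole principle A_d = B_d if d >= (n-1)(w-1) + rc, which the
     bound of the theorem guarantees because binom(n+w-1, w-1) >= w n (w-2) when
     3 <= w <= n. *)

(** * Pointwise function rings and Ryser's formula *)

HB.instance Definition _ (I : finType) (R : comPzRingType) :=
  GRing.PzRing_hasCommutativeMul.Build {ffun I -> R} (@ffun_mulC I R).

Lemma prod_ffunE (I J : finType) (R : comPzRingType) (F : I -> {ffun J -> R}) k :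
  (\prod_i F i) k = \prod_i F i k.
Proof.
by apply: (big_morph (fun q : {ffun J -> R} => q k)) => [p q|]; rewrite ffunE.
Qed.

Section ConstFfun.
Variables (K R : comPzRingType) (io : {rmorphism K -> R}) (I : finType).

Definition ffun_const (c : K) : {ffun I -> R} := [ffun=> io c].

Fact ffun_const_is_zmod_morphism : zmod_morphism ffun_const.
Proof. by move=> a b; apply/ffunP => i; rewrite !ffunE rmorphB. Qed.

Fact ffun_const_is_monoid_morphism : monoid_morphism ffun_const.
Proof.
by split=> [|a b]; apply/ffunP => i; rewrite !ffunE ?rmorph1 ?rmorphM.
Qed.

HB.instance Definition _ :=
  GRing.isZmodMorphism.Build K {ffun I -> R} ffun_const
    ffun_const_is_zmod_morphism.
HB.instance Definition _ :=
  GRing.isMonoidMorphism.Build K {ffun I -> R} ffun_const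
    ffun_const_is_monoid_morphism.
End ConstFfun.

(** Inclusion-exclusion: expanding the products gives the maps with values in [S], and the signed
    sum over [S] keeps only the surjective ones, that is, the permutations. *)
Lemma ryser (R : comPzRingType) (I : finType) (u : I -> I -> R) :
  \sum_(s : {perm I}) \prod_i u (s i) i =
  \sum_(S : {set I}) (-1) ^+ #|~: S| * \prod_i \sum_(j in S) u j i.
Proof.
pose F (f : {ffun I -> I}) := \prod_i u (f i) i.
have signs (A : {set I}) :
    \sum_(S : {set I} | A \subset S) (-1) ^+ #|~: S| = (A == setT)%:R :> R.
  have [->|] := eqVneq A setT.
    rewrite (bigD1 setT) //= setCT cards0 expr0 big1 ?addr0 // => S.
    by rewrite subTset => /andP[->].
  rewrite -subTset => /subsetPn[a _ aA].
  rewrite (bigID (fun S : {set I} => a \in S)) /=.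
  rewrite [X in X + _](reindex_onto (fun S => a |: S) (fun S => S :\ a)) /=; last first.
    by move=> S /andP[_ aS]; rewrite setD1K.
  rewrite [X in X + _](eq_bigl (fun S : {set I} => (A \subset S) && (a \notin S))).
    rewrite -big_split big1 // => S /andP[_ aS] /=.
    have -> : ~: S = a |: ~: (a |: S).
      by apply/setP => x; rewrite !inE; case: eqVneq => // ->.
    by rewrite cardsU1 !inE eqxx /= exprS mulN1r subrr.
  move=> S; rewrite setU11 andbT.
  have -> : ((a |: S) :\ a == S) = (a \notin S).
    apply/eqP/idP => [<-|aS]; first by rewrite !inE eqxx.
    by rewrite setU1K.
  case aS: (a \in S); first by rewrite !andbF.
  rewrite !andbT; apply/subsetP/subsetP => AS x xA; have := AS x xA.
    by rewrite !inE; case: eqVneq => // xa _; rewrite -xa xA in aA.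
  by rewrite !inE => ->; rewrite orbT.
transitivity (\sum_(f : {ffun I -> I}) (f @: setT == setT)%:R * F f); last first.
  under eq_bigr => f _ do rewrite -signs mulr_suml.
  rewrite (exchange_big_dep xpredT) //=; apply: eq_bigr => S _.
  rewrite bigA_distr_big_dep /= big_distrr /=; apply: eq_big => f.
    rewrite /F; apply/subsetP/familyP => fS x.
      by apply: fS; rewrite imset_f ?inE.
    by case/imsetP => i _ ->; apply: fS.
  by [].
rewrite (bigID (fun f : {ffun I -> I} => injectiveb f)) /= [X in _ + X]big1.
  rewrite addr0 [RHS](reindex (@pval I)) /=; last first.
    exists (insubd (1%g : {perm I})) => /= f Uf; first exact/val_inj/insubdK.
    exact: insubdK.
  apply: eq_big => s; first by rewrite (valP s).
  move=> _; rewrite (_ : _ @: _ = setT) ?eqxx ?mul1r /F.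
    by apply: eq_bigr => i _; rewrite pvalE.
  apply/setP => i; rewrite inE; apply/imsetP.
  by exists (s^-1 i)%g; rewrite // pvalE permKV.
move=> f /negP finj; case: eqP => [fT|]; last by rewrite mul0r.
case: finj; apply/injectiveP => x y; apply: (imset_injP _) => //.
by rewrite fT.
Qed.

(** * Spans, graded pieces and points of the moment curve *)

Section Span.
Variables (K : numFieldType) (R : comPzRingType) (io : {rmorphism K -> R}).
Implicit Types (T X L : R -> Prop) (x y z l : R).

(** Algebras over [K] are rings with a morphism [io], so that the same notions serve [Q] and the
    ring of [Q]-valued functions with constants as scalars. *)
Definition subspace T :=
  [/\ T 0, forall x y, T x -> T y -> T (x + y) & forall c x, T x -> T (io c * x)].

Inductive span X : R -> Prop :=
| span0 : span X 0
| span_gen x of X x : span X x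
| spanD x y of span X x & span X y : span X (x + y)
| spanZ c x of span X x : span X (io c * x).

Lemma span_subspace X : subspace (span X).
Proof. by split; [apply: span0 | apply: spanD | apply: spanZ]. Qed.

Lemma span_sub X T : subspace T -> (forall x, X x -> T x) ->
  forall x, span X x -> T x.
Proof.
by case=> T0 TD TZ XT x; elim=> //; [move=> ? ? _ ? _ | move=> ? ? _]; auto.
Qed.

Lemma subspace_sum T (I : Type) (r : seq I) (P : pred I) (F : I -> R) :
  subspace T -> (forall i, P i -> T (F i)) -> T (\sum_(i <- r | P i) F i).
Proof. by case=> T0 TD _ TF; apply: big_ind. Qed.

Lemma subspace_scale T c x : subspace T -> c != 0 -> T (io c * x) -> T x.
Proof.
case=> _ _ TZ c0 /(TZ c^-1).
by rewrite mulrA -rmorphM mulVf // rmorph1 mul1r.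
Qed.

Lemma subspace_natmul T k x : subspace T -> (0 < k)%N -> T (x *+ k) -> T x.
Proof.
move=> sT k0 Tx; apply: (@subspace_scale _ k%:R) => //.
  by rewrite pnatr_eq0 -lt0n.
by rewrite rmorph_nat mulr_natl.
Qed.

Lemma subspace_addKr T x y : subspace T -> T y -> T (x + y) -> T x.
Proof.
case=> _ TD TZ /(TZ (-1)); rewrite rmorphN1 mulN1r => Ty /TD/(_ Ty).
by rewrite addrK.
Qed.

Lemma subspaceMr T y : subspace T -> subspace (fun x => T (x * y)).
Proof.
case=> T0 TD TZ; split=> [|a b|c a]; rewrite ?mul0r ?mulrDl //; first exact: TD.
by rewrite -mulrA; apply: TZ.
Qed.

Lemma subspaceMl T y : subspace T -> subspace (fun x => T (y * x)).
Proof.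
case=> T0 TD TZ; split=> [|a b|c a]; rewrite ?mulr0 ?mulrDr //; first exact: TD.
by rewrite mulrCA; apply: TZ.
Qed.

Definition prods L d x := exists2 l : 'I_d -> R, forall i, L (l i) & x = \prod_i l i.

(* The degree d part of the subalgebra generated by L. *)
Definition hom L d := span (prods L d).

Lemma hom_subspace L d : subspace (hom L d).
Proof. exact: span_subspace. Qed.

Lemma hom1 L : hom L 0 1.
Proof. by apply: span_gen; exists (fun=> 0) => [[]|]; rewrite // big_ord0. Qed.

Lemma homS L d l x : L l -> hom L d x -> hom L d.+1 (l * x).
Proof.
move=> Ll; apply: (span_sub (T := fun x => hom L d.+1 (l * x))).
  exact/subspaceMl/hom_subspace.
move=> _ [m Lm ->]; apply: span_gen.
exists (fun i => if unlift ord0 i is Some j then m j else l).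
  by move=> i; case: unliftP.
rewrite big_ord_recl unlift_none; congr (_ * _).
by apply: eq_bigr => i _; rewrite liftK.
Qed.

Lemma homS_ind L d T : subspace T ->
  (forall l x, L l -> hom L d x -> T (l * x)) -> forall x, hom L d.+1 x -> T x.
Proof.
move=> sT TS; apply: span_sub => // _ [l Ll ->]; rewrite big_ord_recl.
by apply: TS => //; apply: span_gen; exists (fun i => l (lift ord0 i)).
Qed.

Lemma hom0_ind L T : subspace T -> T 1 -> forall x, hom L 0 x -> T x.
Proof. by move=> sT T1; apply: span_sub => // _ [l _ ->]; rewrite big_ord0. Qed.

Lemma hom_gen L l : L l -> hom L 1 l.
Proof. by move=> Ll; rewrite -[l]mulr1; apply/homS/hom1. Qed.

Lemma homM L d e x y : hom L d x -> hom L e y -> hom L (d + e) (x * y).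
Proof.
move=> + yL; elim: d x => [|d IHd].
  apply: hom0_ind; first exact/subspaceMr/hom_subspace.
  by rewrite mul1r.
apply: homS_ind; first exact/subspaceMr/hom_subspace.
by move=> l x Ll xL; rewrite -mulrA addSn; apply/homS/IHd.
Qed.

Lemma homX L l d : L l -> hom L d (l ^+ d).
Proof.
by move=> Ll; elim: d => [|d IHd]; rewrite ?exprS; [apply: hom1 | apply: homS].
Qed.

Lemma hom_prod L (I : finType) (A : {set I}) (f : I -> R) :
  (forall i, i \in A -> L (f i)) -> hom L #|A| (\prod_(i in A) f i).
Proof.
move=> Lf; rewrite -sum1_card.
apply: (big_rec2 (fun d x => hom L d x)); first exact: hom1.
by move=> i d x iA; rewrite add1n; apply/homS/Lf.
Qed.

Lemma hom_mono L L' d x : (forall l, L l -> L' l) -> hom L d x -> hom L' d x.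
Proof.
move=> LL'; apply: span_sub; first exact: hom_subspace.
by move=> _ [l Ll ->]; apply: span_gen; exists l => // i; apply/LL'/Ll.
Qed.

(** Polarization: [ryser] for a matrix with equal columns writes d! times a product as a signed sum
    of d-th powers. *)
Lemma hom_powers L d x : subspace L -> hom L d x ->
  span (fun z => exists2 l, L l & z = l ^+ d) x.
Proof.
move=> sL; apply: span_sub; first exact: span_subspace.
move=> _ [l Ll ->]; set T := span _.
have sT : subspace T by apply: span_subspace.
apply: (subspace_natmul sT (fact_gt0 d)).
have <- : \sum_(s : 'S_d) \prod_i l (s i) = (\prod_i l i) *+ d`!.
  rewrite -card_Sn -sumr_const; apply: eq_bigr => s _.
  by rewrite [RHS](reindex_inj (@perm_inj _ s)).
rewrite (ryser (fun i _ => l i)); apply: subspace_sum => // S _.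
rewrite -[_ ^+ _](rmorph_sign io) prodr_const card_ord; case: sT => _ _; apply.
by apply: span_gen; exists (\sum_(j in S) l j) => //; apply: subspace_sum.
Qed.

Definition lin (w : nat) (y : 'I_w -> R) l :=
  exists c : 'I_w -> K, l = \sum_a io (c a) * y a.

Lemma lin_subspace (w : nat) (y : 'I_w -> R) : subspace (lin y).
Proof.
split=> [|_ _ [a ->] [b ->]|k _ [a ->]].
- by exists (fun=> 0); rewrite big1 // => i _; rewrite rmorph0 mul0r.
- exists (fun i => a i + b i); rewrite -big_split; apply: eq_bigr => i _.
  by rewrite rmorphD mulrDl.
- exists (fun i => k * a i); rewrite mulr_sumr; apply: eq_bigr => i _.
  by rewrite rmorphM mulrA.
Qed.

Lemma lin_gen (w : nat) (y : 'I_w -> R) a : lin y (y a).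
Proof.
exists (fun b => (b == a)%:R); rewrite (bigD1 a) //= eqxx rmorph1 mul1r.
by rewrite big1 ?addr0 // => b /negbTE ->; rewrite rmorph0 mul0r.
Qed.

Lemma lin_sub (w : nat) (y : 'I_w -> R) T : subspace T -> (forall a, T (y a)) ->
  forall l, lin y l -> T l.
Proof.
move=> sT Ty _ [c ->]; apply: subspace_sum => // a _.
by case: sT => _ _; apply.
Qed.

Definition curve (w : nat) (y : 'I_w -> R) (t : nat) : R :=
  \sum_(a < w) io (t%:R ^+ a) * y a.

Lemma curve_lin (w : nat) (y : 'I_w -> R) t : lin y (curve y t).
Proof. by exists (fun a : 'I_w => t%:R ^+ a). Qed.

(** Distinct integers have an invertible Vandermonde matrix in characteristic 0; its inverse
    recovers each [y a] from [w] points of the curve. *)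
Lemma curve_span (w : nat) (y : 'I_w -> R) (r : nat) (J : {set 'I_r}) T :
  (w <= #|J|)%N -> subspace T -> (forall j, j \in J -> T (curve y j)) ->
  forall l, lin y l -> T l.
Proof.
move=> wJ sT TJ; apply: lin_sub => // a.
pose e (b : 'I_w) : 'I_r := enum_val (widen_ord wJ b).
have eJ b : e b \in J by apply: enum_valP.
have e_inj : injective e.
  by move=> b b' /enum_val_inj/(congr1 val)/= bb'; apply: val_inj.
pose t : 'rV[K]_w := \row_b (e b)%:R.
pose V := Vandermonde w t.
have Vu : V \in unitmx.
  rewrite unitmxE det_Vandermonde unitfE; apply/prodf_neq0 => i _.
  apply/prodf_neq0 => j ij; rewrite !mxE subr_eq0 eqr_nat.
  by apply/negP => /eqP/val_inj/e_inj ji; rewrite ji ltnn in ij.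
have -> : y a = \sum_b io (invmx V b a) * curve y (e b).
  rewrite /curve; under eq_bigr => b _ do rewrite mulr_sumr.
  rewrite exchange_big /= (eq_bigr (fun a' => io (a' == a)%:R * y a')) => [|a' _].
    rewrite (bigD1 a) //= eqxx rmorph1 mul1r big1 ?addr0 // => a' /negbTE ->.
    by rewrite rmorph0 mul0r.
  under eq_bigr => b _ do rewrite mulrA -rmorphM.
  rewrite -mulr_suml -rmorph_sum /=; congr (io _ * _).
  have := congr1 (fun M : 'M_w => M a' a) (mulmxV Vu); rewrite !mxE => <-.
  by apply: eq_bigr => b _; rewrite !mxE mulrC.
by apply: subspace_sum => // b _; case: sT => _ _; apply; apply: TJ.
Qed.

(* Adding one factor at a time: at least v.+1 points of the curve are unused at
   each step, and these span the linear forms. *)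
Lemma hom_curve (v : nat) (y : 'I_v.+1 -> R) (r : nat) (J : {set 'I_r}) t d T :
  (t + v <= #|J|)%N -> (t <= d)%N -> subspace T ->
  (forall (A : {set 'I_r}) x, A \subset J -> #|A| = t -> hom (lin y) (d - t) x ->
     T ((\prod_(j in A) curve y j) * x)) ->
  forall x, hom (lin y) d x -> T x.
Proof.
elim: t T => [|t IHt] T tJ td sT TA.
  move=> x xd; have := TA set0 x; rewrite big_set0 mul1r; apply.
  - exact: sub0set.
  - exact: cards0.
  - by rewrite subn0.
apply: IHt => //; [by lia | by lia | move=> A x AJ cA].
have -> : (d - t = (d - t.+1).+1)%N by lia.
move: x; apply: homS_ind; first exact: subspaceMl.
move=> l x yl xd.
move: l yl; apply: (@curve_span _ _ _ (J :\: A)).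
- by rewrite cardsD (setIidPr AJ) cA; lia.
- exact: (subspaceMr x (subspaceMl _ sT)).
move=> j /setDP[jJ jA].
have -> : \prod_(i in A) curve y i * (curve y j * x) =
          (\prod_(i in j |: A) curve y i) * x.
  by rewrite big_setU1 //= mulrCA mulrA.
apply: TA => //; last by rewrite cardsU1 jA cA.
by rewrite subUset sub1set jJ.
Qed.

End Span.

(** * Tuples of forms and their common factors *)

Section Slots.
Variables (K : numFieldType) (R : comPzRingType) (io : {rmorphism K -> R}).
Variables (n : nat).
Implicit Types (u v : 'I_n -> R) (G : ('I_n -> R) -> Prop).

Definition update u i x : 'I_n -> R := fun j => if j == i then x else u j.

Lemma update_id u i : update u i (u i) = u.
Proof. by apply: funext => j; rewrite /update; case: eqP => [->|]. Qed.

(** Abstracts the set of tuples that a multilinear map sends into a given subspace. *)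
Definition multisubspace G := forall u i, subspace io (fun x => G (update u i x)).

Lemma multispan (X : 'I_n -> R -> Prop) G u : multisubspace G ->
  (forall v, (forall i, X i (v i)) -> G v) ->
  (forall i, span io (X i) (u i)) -> G u.
Proof.
move=> sG GX uX.
suff H (s : seq 'I_n) w : (forall i, i \in s -> span io (X i) (w i)) ->
    (forall i, i \notin s -> X i (w i)) -> G w.
  by apply: (H (enum 'I_n)) => i; rewrite mem_enum.
elim: s w => [|i s IHs] w ws wX; first by apply: GX => i; apply: wX.
rewrite -(update_id w i); have: span io (X i) (w i) by apply: ws; rewrite mem_head.
apply: (span_sub (T := fun x => G (update w i x))) => // x xX.
apply: IHs => j js.
  rewrite /update; case: eqP => [->|_]; first exact: span_gen.
  by apply: ws; rewrite inE js orbT.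
rewrite /update; case: eqVneq => [-> //|ji]; apply: wX.
by rewrite inE negb_or ji.
Qed.

(* A tuple of forms of large enough degrees in v.+1 variables is a sum of tuples
   all of whose components (in the slots of s) share a factor curve y j: expand
   the first slot into products of many points of the curve (hom_curve), then
   look for the shared factor among these points only. *)
Lemma common_factor (v : nat) (y : 'I_v.+1 -> R) (r : nat) (s : seq 'I_n)
    (J : {set 'I_r}) (d : 'I_n -> nat) G u :
  uniq s -> (size s * v < #|J|)%N ->
  (forall p i0, (p < size s)%N -> ((size s - p.+1) * v < d (nth i0 s p))%N) ->
  multisubspace G ->
  (forall j w, j \in J -> (forall i, i \in s -> hom io (lin io y) (d i).-1 (w i)) ->
     G (fun i => if i \in s then curve io y j * w i else u i)) ->
  (forall i, i \in s -> hom io (lin io y) (d i) (u i)) -> G u.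
Proof.
elim: s J u => [|i s IHs] J u /= us sJ sd sG GJ ud.
  have /card_gt0P[j jJ] : (0 < #|J|)%N by [].
  by apply: (GJ j u).
case/andP: us => si us.
have di : (size s * v < d i)%N by have := sd 0%N i isT; rewrite subSS subn0.
rewrite -(update_id u i); have := ud i (mem_head _ _).
apply: (@hom_curve _ _ io v y r J (size s * v).+1 _
  (fun x => G (update u i x))) => //.
  by rewrite addSn addnC -mulSn.
move=> A x AJ cA xd; apply: (IHs A) => //; first by rewrite cA.
- by move=> p i0 ps; have := sd p.+1 i0 ps; rewrite subSS.
- move=> j w jA wd.
  pose w' := update w i ((\prod_(k in A :\ j) curve io y k) * x).
  rewrite (_ : (fun k => _) = fun k => if k \in i :: s then curve io y j * w' k else u k).
    apply: GJ; first exact: (subsetP AJ).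
    move=> k; rewrite inE /w' /update; case: eqVneq => [->|ki] /= ks; last exact: wd.
    rewrite (_ : (d i).-1 = #|A :\ j| + (d i - (size s * v).+1))%N.
      by apply: homM => //; apply: hom_prod => l _; apply: curve_lin.
    by have := cardsD1 j A; rewrite jA cA; lia.
  apply: funext => k; rewrite inE /w' /update; case: eqVneq => [->|ki] //=.
  by rewrite (negbTE si) mulrA (big_setD1 j).
move=> j js; rewrite /update; case: eqVneq => [ji|_].
  by rewrite -ji js in si.
by apply: ud; rewrite inE js orbT.
Qed.
End Slots.

(** * Brackets and norms *)

Section Bracket.
Variables (K : numFieldType) (Q : comPzRingType) (io : {rmorphism K -> Q}).
Variables (n : nat).
Local Notation P := {ffun 'I_n -> Q}.
Local Notation ioP := (ffun_const io 'I_n).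
Implicit Types (u v l : 'I_n -> P) (x y : P) (L : P -> Prop) (T : Q -> Prop).

(* An element x of P stands for a polynomial in one vector variable, x i for its
   value at the i-th of n vector variables; [br u] symmetrizes the product
   [\prod_i u i i]. *)
Definition br u : Q := \sum_(s : 'S_n) \prod_i u (s i) i.

Definition nrm x : Q := \prod_i x i.

Definition brs L q := exists2 l, forall i, L (l i) & q = br l.

Lemma br_update u i x : br (update u i x) =
  \sum_(s : 'S_n) x ((s^-1)%g i) * \prod_(k | k != (s^-1)%g i) u (s k) k.
Proof.
apply: eq_bigr => s _; rewrite (bigD1 ((s^-1)%g i)) //= /update permKV eqxx.
congr (_ * _); apply: eq_bigr => k ki.
by rewrite -(inj_eq (@perm_inj _ (s^-1)%g)) permK (negbTE ki).
Qed.

Lemma br_multisubspace (T : Q -> Prop) : subspace io T ->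
  multisubspace ioP (fun u => T (br u)).
Proof.
move=> [T0 TD TZ] u i; split=> [|x y|c x]; rewrite !br_update.
- by rewrite big1 // => s _; rewrite ffunE mul0r.
- move=> Tx Ty; rewrite (_ : \sum_s _ = br (update u i x) + br (update u i y)).
    by apply: TD; rewrite br_update.
  by rewrite !br_update -big_split; apply: eq_bigr => s _; rewrite ffunE mulrDl.
- move=> Tx; rewrite (_ : \sum_s _ = io c * br (update u i x)).
    by apply: TZ; rewrite br_update.
  rewrite br_update mulr_sumr; apply: eq_bigr => s _.
  by rewrite !ffunE mulrA.
Qed.

(** Reindexing by the relative permutation [t] of the two sums. The inductions on brackets below
    isolate in this sum the terms equal to a target. *)
Lemma brM l u : br l * br u = \sum_(t : 'S_n) br (fun i => l (t i) * u i).
Proof.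
rewrite [RHS]exchange_big /= [LHS]mulr_sumr; apply: eq_bigr => s _.
rewrite /br (reindex_inj (mulgI s)) mulr_suml /=; apply: eq_bigr => t _.
rewrite -big_split; apply: eq_bigr => i _ /=.
by rewrite ffunE permM.
Qed.

Lemma br_perm (t : 'S_n) u : br (fun i => u (t i)) = br u.
Proof.
rewrite [RHS](reindex_inj (mulIg t)); apply: eq_bigr => s _.
by apply: eq_bigr => i _; rewrite permM.
Qed.

Lemma br_mull x u : br (fun i => x * u i) = nrm x * br u.
Proof.
rewrite mulr_sumr; apply: eq_bigr => s _; rewrite -big_split.
by apply: eq_bigr => i _; rewrite ffunE.
Qed.

Lemma br_const x : br (fun=> x) = nrm x *+ n`!.
Proof. by rewrite -card_Sn -sumr_const. Qed.

Lemma nrmM x y : nrm (x * y) = nrm x * nrm y.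
Proof. by rewrite -big_split; apply: eq_bigr => i _; rewrite ffunE. Qed.

Lemma nrmX x k : nrm (x ^+ k) = nrm x ^+ k.
Proof.
elim: k => [|k IHk]; last by rewrite !exprS nrmM IHk.
by rewrite /nrm big1 // => i _; rewrite ffunE.
Qed.

Lemma nrm_scalar c : nrm (ioP c) = io (c ^+ n).
Proof.
rewrite /nrm; under eq_bigr => i _ do rewrite ffunE.
by rewrite prodr_const card_ord rmorphXn.
Qed.

(** Reduces statements about [br] to the multiplicative [nrm]. *)
Lemma br_polarization u : br u =
  \sum_(S : {set 'I_n}) (-1) ^+ #|~: S| * nrm (\sum_(j in S) u j).
Proof.
rewrite [LHS](ryser (fun i j => u i j)); apply: eq_bigr => S _.
by congr (_ * _); apply: eq_bigr => i _; rewrite sum_ffunE.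
Qed.

Local Notation B L := (hom io (brs L)).

Lemma B_nrm L x : L x -> B L 1 (nrm x).
Proof.
move=> Lx; apply: (@subspace_natmul _ _ io _ n`!); rewrite ?fact_gt0 //.
  exact: hom_subspace.
by rewrite -br_const; apply: hom_gen; exists (fun=> x).
Qed.

Lemma B_nrmX L x k : L x -> B L k (nrm x ^+ k).
Proof.
move=> Lx; elim: k => [|k IHk]; first exact: hom1.
by rewrite exprS -add1n; apply/homM/IHk/B_nrm.
Qed.

Lemma br_hom_powers L d u T : subspace ioP L -> subspace io T ->
  (forall l, (forall i, L (l i)) -> T (br (fun i => l i ^+ d))) ->
  (forall i, hom ioP L d (u i)) -> T (br u).
Proof.
move=> sL sT TL uL.
apply: (multispan (br_multisubspace sT) _ (fun i => hom_powers sL (uL i))).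
move=> v vL.
have /fin_all_exists2[l Ll vl] i : exists2 l, L l & v i = l ^+ d by apply: vL.
by rewrite (_ : v = fun i => l i ^+ d); [apply: TL | apply: funext].
Qed.

End Bracket.

(** * Binary forms *)

Section Pencil.
Variables (K : numClosedFieldType) (Q : comPzRingType) (io : {rmorphism K -> Q}).
Variables (n : nat).
Local Notation P := {ffun 'I_n -> Q}.
Local Notation ioP := (ffun_const io 'I_n).
Implicit Types (x y l : P).

(** For [p] of degree at most [d], the binary form x^d p(y / x). *)
Definition homogenize x y d (p : {poly K}) : P :=
  \sum_(k < d.+1) ioP p`_k * x ^+ (d - k) * y ^+ k.

Lemma homogenize_subspace x y d :
  subspace ioP (fun z =>
    exists2 p : {poly K}, (size p <= d.+1)%N & z = homogenize x y d p).
Proof.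
split=> [|_ _ [p sp ->] [q sq ->]|c _ [p sp ->]].
- exists 0; rewrite ?size_poly0 // /homogenize big1 // => k _.
  by rewrite coef0 rmorph0 !mul0r.
- exists (p + q); first by rewrite (leq_trans (size_polyD _ _)) // geq_max sp.
  by rewrite -big_split; apply: eq_bigr => k _; rewrite coefD rmorphD !mulrDl.
- exists (c *: p); first exact: leq_trans (size_scale_leq _ _) _.
  by rewrite mulr_sumr; apply: eq_bigr => k _; rewrite coefZ rmorphM !mulrA.
Qed.

Lemma homogenize_mul x y d (p : {poly K}) a b : (size p <= d.+1)%N ->
  homogenize x y d.+1 (p * (a%:P + b *: 'X)) =
  homogenize x y d p * (ioP a * x + ioP b * y).
Proof.
move=> sp; rewrite mulrDr -scalerAr mulrC mul_polyC.
have -> : homogenize x y d.+1 (a *: p + b *: (p * 'X)) =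
  homogenize x y d.+1 (a *: p) + homogenize x y d.+1 (b *: (p * 'X)).
  by rewrite -big_split; apply: eq_bigr => k _; rewrite coefD rmorphD !mulrDl.
rewrite mulrDr; congr (_ + _).
  rewrite /homogenize big_ord_recr /= coefZ nth_default // mulr0 rmorph0 !mul0r.
  rewrite addr0 mulr_suml; apply: eq_bigr => k _.
  rewrite coefZ rmorphM subSn ?exprS -1?ltnS //; ring.
rewrite /homogenize big_ord_recl /= coefZ coefMX eqxx mulr0 rmorph0 !mul0r.
rewrite add0r mulr_suml; apply: eq_bigr => k _.
rewrite coefZ coefMX /= rmorphM exprS subSS; ring.
Qed.

Definition pencil x y l := exists a b, l = ioP a * x + ioP b * y.

Lemma hom_pencil x y d z : hom ioP (pencil x y) d z ->
  exists2 p : {poly K}, (size p <= d.+1)%N & z = homogenize x y d p.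
Proof.
elim: d z => [|d IHd].
  apply: hom0_ind; first exact: homogenize_subspace.
  exists 1; rewrite ?size_poly1 // /homogenize big_ord_recl big_ord0.
  by rewrite coef1 /= !expr0 rmorph1 !mulr1 addr0.
apply: homS_ind; first exact: homogenize_subspace.
move=> _ z [a [b ->]] /IHd[p sp ->]; exists (p * (a%:P + b *: 'X)).
  rewrite mulrDr (leq_trans (size_polyD _ _)) // geq_max; apply/andP; split.
    rewrite mulrC mul_polyC (leq_trans (size_scale_leq _ _)) //; exact: leqW.
  rewrite -scalerAr (leq_trans (size_scale_leq _ _)) //.
  by rewrite (leq_trans (size_polyMleq _ _)) // size_polyX addn2.
by rewrite homogenize_mul // mulrC.
Qed.

(* Binary forms over a closed field are products of linear forms, and nrm is
   multiplicative. *)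
Lemma B_nrm_pencil L x y d z : (forall l, pencil x y l -> L l) ->
  hom ioP (pencil x y) d z -> hom io (brs L) d (nrm z).
Proof.
move=> xyL /hom_pencil[p sp ->].
have [r [c [rd ->]]] : exists r c, (size r <= d)%N /\
    p = c *: \prod_(a <- r) ('X - a%:P).
  have [r def_p] := closed_field_poly_normal p.
  (* If p = 0, its degree does not bound the size of [r]; the empty list is taken instead, with c =
     0. *)
  have [c0|nz] := eqVneq (lead_coef p) 0.
    by exists [::], 0; split=> //; rewrite def_p c0 !scale0r.
  exists r, (lead_coef p); split=> //.
  by move: sp; rewrite def_p size_scale // size_prod_XsubC.
(* The missing [d - size r] roots lie at infinity and contribute powers of [x]. *)
elim: r d rd {p sp} => [|a r IHr] d rd.
  rewrite big_nil alg_polyC /homogenize big_ord_recl /= big1 => [|k _]; last first.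
    by rewrite coefC rmorph0 !mul0r.
  rewrite addr0 coefC expr0 mulr1 subn0 nrmM nrm_scalar nrmX.
  have [_ _ BZ] := hom_subspace io (brs L) d; apply: BZ.
  by apply/B_nrmX/xyL; exists 1, 0; rewrite rmorph1 rmorph0 mul1r mul0r addr0.
case: d rd => // d rd; rewrite big_cons mulrC scalerAl.
have -> : 'X - a%:P = (- a)%:P + 1 *: 'X :> {poly K}.
  by rewrite scale1r polyCN addrC.
rewrite homogenize_mul; last first.
  by rewrite (leq_trans (size_scale_leq _ _)) // size_prod_XsubC.
rewrite nrmM -addn1; apply: homM; first exact: IHr.
by apply/B_nrm/xyL; exists (- a), 1.
Qed.

Lemma br_pencil L x y d (u : 'I_n -> P) : (forall l, pencil x y l -> L l) ->
  (forall i, hom ioP (pencil x y) d (u i)) -> hom io (brs L) d (br u).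
Proof.
move=> xyL uxy; rewrite br_polarization; apply: subspace_sum => [|S _].
  exact: hom_subspace.
rewrite -[_ ^+ _](rmorph_sign io).
have [_ _ BZ] := hom_subspace io (brs L) d; apply: BZ; apply: (B_nrm_pencil xyL).
by apply: subspace_sum => //; apply: hom_subspace.
Qed.

End Pencil.

(** * Powers of a norm as multipliers into the bracket algebra *)

Section Conductor.
Variables (K : numClosedFieldType) (Q : comPzRingType) (io : {rmorphism K -> Q}).
Variables (n : nat).
Local Notation P := {ffun 'I_n -> Q}.
Local Notation ioP := (ffun_const io 'I_n).
Implicit Types (x y l : P).
Local Notation B L := (hom io (brs L)).

(** Up to a scalar and the factor nrm(x)^k, this bracket is the power sum of y / x^a. For y = l^a
    all slots are forms in [x] and [l], and [br_pencil] applies. *)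
Lemma B_power_sum L x a k y i0 : subspace ioP L -> L x -> (a <= k)%N ->
  hom ioP L a y ->
  B L k (br (update (fun=> x ^+ k) i0 (x ^+ (k - a) * y))).
Proof.
move=> sL Lx ak /(hom_powers sL).
have sB := hom_subspace io (brs L) k.
have := subspaceMl (x ^+ (k - a)) (br_multisubspace sB (fun=> x ^+ k) i0).
move/span_sub; apply=> _ [l Ll ->].
apply: (@br_pencil _ _ _ _ _ x l) => [_ [b [c ->]]|i].
  by case: sL => _ LD LZ; apply: LD; apply: LZ.
have xp : pencil io x l x.
  by exists 1, 0; rewrite rmorph1 rmorph0 mul1r mul0r addr0.
have lp : pencil io x l l.
  by exists 0, 1; rewrite rmorph1 rmorph0 mul1r mul0r add0r.
rewrite /update; case: eqP => _; last exact: homX.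
by rewrite -{1}(subnK ak); apply: homM; apply: homX.
Qed.

(* As in the expression of monomial symmetric functions by power sums: multiply
   the tuple u with slot i0 emptied by the power sum of u i0, and induct on the
   set S of nonempty slots; power sums are handled by B_power_sum. *)
Lemma B_total_degree L x (a : 'I_n -> nat) k (u : 'I_n -> P) :
  subspace ioP L -> L x -> (\sum_i a i <= k)%N ->
  (forall i, hom ioP L (a i) (u i)) ->
  B L k (br (fun i => x ^+ (k - a i) * u i)).
Proof.
move=> sL Lx.
suff H (S : {set 'I_n}) b k' (w : 'I_n -> P) :
    (forall i, i \notin S -> b i = 0%N /\ w i = 1) -> (\sum_i b i <= k')%N ->
    (forall i, hom ioP L (b i) (w i)) ->
    B L k' (br (fun i => x ^+ (k' - b i) * w i)).
  by move=> ak uL; apply: (H setT) => // i; rewrite inE.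
have [m] := ubnP #|S|; elim: m S b k' w => // m IHm S b {a}k w {u}Sm Sb bk wL.
have sB := hom_subspace io (brs L) k.
have [S0|[i0 i0S]] := set_0Vmem S.
  rewrite (_ : (fun i => _) = fun=> x ^+ k); last first.
    apply: funext => i; have [|-> ->] := Sb i; first by rewrite S0 inE.
    by rewrite subn0 mulr1.
  by rewrite br_const nrmX; case: sB => _ _ BZ; rewrite -mulr_natl -(rmorph_nat io);
    apply/BZ/B_nrmX.
set a := b i0; pose b0 i := if i == i0 then 0%N else b i.
pose w0 := update w i0 1.
have sum_b : (\sum_i b i = a + \sum_i b0 i)%N.
  rewrite (bigD1 i0) //= [in RHS](bigD1 i0) //= /b0 eqxx add0n; congr (_ + _)%N.
  by apply: eq_bigr => i /negbTE ->.
have ak : (a <= k)%N by lia.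
(* [br z] stands for the power sum of [w i0], in degree [a]; the other factor has slot [i0] emptied
   and degree [k - a]. *)
pose z := update (fun=> x ^+ a) i0 (w i0).
have zB : B L a (br z).
  have := B_power_sum i0 sL Lx (leqnn a) (wL i0).
  by rewrite subnn expr0 mul1r.
have wB : B L (k - a) (br (fun i => x ^+ (k - a - b0 i) * w0 i)).
  apply: (IHm (S :\ i0)).
  - by rewrite (cardsD1 i0) i0S in Sm.
  - move=> i; rewrite !inE negb_and negbK /b0 /w0 /update.
    by case: eqP => //= _ /Sb[-> ->].
  - by lia.
  - by move=> i; rewrite /b0 /w0 /update; case: eqP => // _; apply: hom1.
have := homM zB wB; rewrite subnKC // brM.
set tgt := br (fun i => x ^+ (k - b i) * w i).
(* The factor [w i0] lands in the slot [t^-1 i0]. If that is [i0] or an empty slot, the term is the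
   target up to a swap of slots; otherwise two nonempty slots merge and the induction applies. *)
pose A := [set t : 'S_n | (t^-1 i0)%g \in i0 |: ~: S].
rewrite (bigID (mem A)) /=.
have -> : \sum_(t in A) br (fun i => z (t i) * (x ^+ (k - a - b0 i) * w0 i)) =
    tgt *+ #|A|.
  rewrite -sumr_const; apply: eq_bigr => t.
  rewrite !inE; set j := (t^-1 i0)%g => jA.
  have tj i : (t i == i0) = (i == j) by rewrite -(inj_eq (@perm_inj _ t) i j) permKV.
  have jw0 : b0 j = 0%N /\ w0 j = 1.
    rewrite /b0 /w0 /update; case: eqVneq => // ji; apply: Sb.
    by rewrite (negbTE ji) in jA.
  rewrite /tgt -[RHS](br_perm (tperm i0 j)); congr br; apply: funext => i.
  have xab i' : i' != i0 -> x ^+ a * x ^+ (k - a - b0 i') = x ^+ (k - b0 i').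
    move=> _; rewrite -exprD; congr (_ ^+ _).
    have := sum_b; rewrite (bigD1 i') //= => sb.
    by move: bk; rewrite sum_b (bigD1 i') //=; lia.
  rewrite /z /update; have [->|ij] := eqVneq i j.
    by rewrite tj eqxx tpermR jw0.1 jw0.2 subn0 mulr1 mulrC.
  rewrite tj (negbTE ij).
  have [ii0|ii0] := eqVneq i i0.
    rewrite ii0 in ij *; rewrite tpermL; have [|-> ->] := Sb j.
      by move: jA; rewrite eq_sym (negbTE ij).
    by rewrite /b0 /w0 /update eqxx !subn0 !mulr1 -exprD subnKC.
  rewrite tpermD 1?eq_sym // mulrA xab // /b0 /w0 /update (negbTE ii0) //.
have sumB : B L k (\sum_(t | t \notin A)
    br (fun i => z (t i) * (x ^+ (k - a - b0 i) * w0 i))).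
  apply: (subspace_sum (io := io)); first exact: sB.
  move=> t; rewrite !inE; set j := (t^-1 i0)%g.
  rewrite negb_or negbK => /andP[ji0 jS].
  have tj i : (t i == i0) = (i == j) by rewrite -(inj_eq (@perm_inj _ t) i j) permKV.
  pose b1 i := (b0 i + (i == j) * a)%N.
  pose w1 i := w0 i * (if i == j then w i0 else 1).
  rewrite (_ : (fun i => _) = fun i => x ^+ (k - b1 i) * w1 i).
    apply: (IHm (S :\ i0)).
    - by rewrite (cardsD1 i0) i0S in Sm.
    - move=> i iS; rewrite /b1 /w1; have [ij|ij] := eqVneq i j.
        by move: iS; rewrite ij !inE ji0 jS.
      rewrite mul0n addn0 mulr1 /b0 /w0 /update.
      case: eqVneq => // ii0; apply: Sb; by move: iS; rewrite !inE ii0.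
    - rewrite big_split /= [X in (_ + X)%N](bigD1 j) //= eqxx mul1n.
      rewrite [X in (_ + (_ + X))%N]big1 => [|i /negbTE -> //].
      by rewrite addn0 addnC -sum_b.
    - move=> i; rewrite /b1 /w1; apply: homM.
        by rewrite /b0 /w0 /update; case: eqP => // _; apply: hom1.
      by case: eqP => _; [rewrite mul1n; apply: wL | apply: hom1].
  apply: funext => i; rewrite /b1 /w1 /z /update; have [->|ij] := eqVneq i j.
    by rewrite tj eqxx mul1n -subnDA addnC; ring.
  rewrite tj (negbTE ij) mul0n addn0 mulr1 mulrA -exprD.
  congr (_ ^+ _ * _).
  by move: bk; rewrite sum_b (bigD1 i) //=; lia.
move=> /(subspace_addKr sB sumB) tgtA; apply: (subspace_natmul sB _ tgtA).
by apply/card_gt0P; exists 1%g; rewrite !inE invg1 perm1 eqxx.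
Qed.

(** The bound on [c] means that the total degree [n * m] is at most [c + m]. *)
Lemma B_conductor L x m c (u : 'I_n -> P) :
  subspace ioP L -> L x -> (n.-1 * m <= c)%N ->
  (forall i, hom ioP L m (u i)) -> B L (c + m) (nrm x ^+ c * br u).
Proof.
move=> sL Lx mc uL; rewrite -nrmX -br_mull.
have := @B_total_degree L x (fun=> m) (c + m) u sL Lx _ uL; rewrite addnK; apply.
rewrite sum_nat_const card_ord; case: (n) mc => //= n' mc.
by rewrite mulSn addnC leq_add2r.
Qed.
End Conductor.

(** * Splitting off a bracket of degree one in large degree *)

(** Slots are added greedily, with a threshold lowered by [v] each time. For m > (n-1)v the chosen
    exponents suit [common_factor], and the others fall short of them by more than [v]. *)
Lemma greedy_chain (n : nat) (k : 'I_n -> nat) (m v : nat) :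
  exists s : seq 'I_n, [/\ uniq s,
    forall p i0, (p < size s)%N -> (m <= k (nth i0 s p) + p * v)%N
    & forall i, i \notin s -> (k i + size s * v < m)%N].
Proof.
suff H (s : seq 'I_n) : uniq s ->
    (forall p i0, (p < size s)%N -> (m <= k (nth i0 s p) + p * v)%N) ->
    exists s : seq 'I_n, [/\ uniq s,
    forall p i0, (p < size s)%N -> (m <= k (nth i0 s p) + p * v)%N
    & forall i, i \notin s -> (k i + size s * v < m)%N].
  exact: (H [::]).
have [r] := ubnP (n - size s); elim: r s => // r IHr s sr us sm.
have [/existsP[i /andP[si mi]]|/existsPn ns] :=
  boolP [exists i, (i \notin s) && (m <= k i + size s * v)%N]; last first.
  by exists s; split=> // i si; have := ns i; rewrite si /= -ltnNge.
have ur : uniq (rcons s i) by rewrite rcons_uniq si.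
have rn : (size (rcons s i) <= n)%N.
  by have := uniq_leq_size ur (fun j _ => mem_enum 'I_n j); rewrite size_enum_ord.
apply: (IHr (rcons s i)) => // [|p i0]; move: rn; rewrite size_rcons => rn.
  by lia.
rewrite ltnS leq_eqVlt nth_rcons => /predU1P[->|ps]; first by rewrite ltnn eqxx.
by rewrite ps; apply: sm.
Qed.

(* One unit is moved from each element of s to each element of t @^-1: s. *)
Lemma sum_squares_lt (n : nat) (k : 'I_n -> nat) (s : {set 'I_n}) (t : 'S_n) :
  (forall i j, i \in s -> j \notin s -> (k j + 2 <= k i)%N) ->
  t @^-1: s != s ->
  (\sum_i (k i - (i \in s) + (t i \in s)) ^ 2 < \sum_i k i ^ 2)%N.
Proof.
move=> gap; set A := _ @^-1: s => As.
have cA : #|A| = #|s| by apply: card_preimset; apply: perm_inj.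
have [j jA js] : exists2 j, j \in A & j \notin s.
  by apply/subsetPn; apply: contra As => sA; rewrite eqEcard sA cA leqnn.
have [i iS iA] : exists2 i, i \in s & i \notin A.
  by apply/subsetPn; apply: contra As => sA; rewrite eq_sym eqEcard sA cA leqnn.
have [h hs hns] : exists2 h, forall i, i \in s -> (h <= k i)%N &
    forall j, j \notin s -> (k j + 2 <= h)%N.
  case: (arg_minnP k iS) => i' i's mini.
  by exists (k i') => // j' /gap; apply.
have h0 : (0 < h)%N by have := hns j js; lia.
(* With a correction of slope 2h - 1 the inequality holds termwise; the corrections cancel, as
   [t @^-1: s] and [s] have equal size, and slot [j] gives strictness. *)
suff : (\sum_i ((k i - (i \in s) + (t i \in s)) ^ 2 + (h.*2.-1 * (i \in s) + (i == j))) <=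
        \sum_i (k i ^ 2 + h.*2.-1 * (t i \in s)))%N.
  rewrite !big_split /= -!big_distrr /=.
  have -> : (\sum_i (t i \in s) = \sum_i (i \in s))%N.
    by rewrite [RHS](reindex_inj (@perm_inj _ t)).
  have -> : (\sum_i (i == j) = 1)%N.
    by rewrite (bigD1 j) //= eqxx big1 // => i' /negbTE ->.
  by rewrite addn1 addnS -addSn leq_add2r.
apply: leq_sum => i' _; have := hs i'; have := hns i'.
have ji : (i' == j) -> (t i' \in s) && (i' \notin s).
  by move=> /eqP->; rewrite js andbT; move: jA; rewrite inE.
case: (i' \in s) ji => /= ji hn' hs'.
  rewrite (_ : (i' == j) = false); last by apply/negP => /ji; rewrite andbF.
  have := hs' isT; case: (t i' \in s) => /=; nia.
have := hn' isT; case: (t i' \in s) ji => /= ji; case: (i' == j) ji => //= ji; nia.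
Qed.

Section Generation.
Variables (K : numClosedFieldType) (Q : comPzRingType) (io : {rmorphism K -> Q}).
Variables (n : nat).
Local Notation P := {ffun 'I_n -> Q}.
Local Notation ioP := (ffun_const io 'I_n).
Implicit Types (x z : P) (u l : 'I_n -> P) (L : P -> Prop) (T : Q -> Prop).
Local Notation B L := (hom io (brs L)).

Lemma hom_cone (v : nat) (y : 'I_v -> P) x L d z :
  (forall z, L z -> exists c, lin ioP y (z - ioP c * x)) ->
  hom ioP L d z ->
  span ioP (fun z => exists k w, [/\ (k <= d)%N, hom ioP (lin ioP y) k w
                                   & z = x ^+ (d - k) * w]) z.
Proof.
move=> Lxy; elim: d z => [|d IHd].
  apply: hom0_ind; first exact: span_subspace.
  by apply: span_gen; exists 0%N, 1; rewrite expr0 mulr1; split=> //; apply: hom1.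
apply: homS_ind; first exact: span_subspace.
move=> l z /Lxy[c yl] /IHd.
apply: (span_sub (T := fun z => _ (l * z))).
  exact/subspaceMl/span_subspace.
move=> _ [k [w [kd yw ->]]]; rewrite -[l](subrK (ioP c * x)) mulrDl.
apply: spanD.
  apply: span_gen; exists k.+1, ((l - ioP c * x) * w); split=> //.
    exact: homS.
  by rewrite subSS mulrCA.
rewrite -mulrA; apply: spanZ; apply: span_gen; exists k, w; split=> //.
  exact: leqW.
by rewrite mulrA -exprS -subSn.
Qed.

Lemma br_mul_multisubspace (T : Q -> Prop) (a : 'I_n -> P) : subspace io T ->
  multisubspace ioP (fun u => T (br (fun i => a i * u i))).
Proof.
move=> sT u i.
have := subspaceMl (a i) (br_multisubspace sT (fun i => a i * u i) i).
congr (subspace _ _); apply: funext => z; congr (T (br _)).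
by apply: funext => j; rewrite /update; case: eqP => // ->.
Qed.

(* Among the tuples x ^ (m - k_i) w_i, with w_i of degree k_i in the remaining
   variables, those with sum of the k_i ^ 2 minimal are multiplied out first: the
   bracket of the forms equal to [curve y j] on s and to x elsewhere reproduces
   the given tuple and tuples with a smaller sum of squares. *)
Lemma br_generated (v : nat) (y : 'I_v.+1 -> P) x L m T : (0 < v)%N ->
  L x -> (forall z, lin ioP y z -> L z) ->
  (forall z, L z -> exists c, lin ioP y (z - ioP c * x)) ->
  (n.-1 * v < m)%N -> subspace io T ->
  (forall l u, (forall i, L (l i)) -> (forall i, hom ioP L m.-1 (u i)) ->
    T (br l * br u)) ->
  forall u, (forall i, hom ioP L m (u i)) -> T (br u).
Proof.
move=> v0 Lx yL Lxy mv sT TL u uL.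
apply: (multispan (br_multisubspace sT) _ (fun i => hom_cone Lxy (uL i))).
move=> {uL}u uX.
have [k uk] : exists k : 'I_n -> nat, forall i, exists w,
    [/\ (k i <= m)%N, hom ioP (lin ioP y) (k i) w & u i = x ^+ (m - k i) * w].
  exact: (fin_all_exists uX).
have [w] := fin_all_exists uk.
move=> {uX}uk; have -> : u = fun i => x ^+ (m - k i) * w i.
  by apply: funext => i; case: (uk i).
have km i : (k i <= m)%N by case: (uk i).
have wk i : hom ioP (lin ioP y) (k i) (w i) by case: (uk i).
move: {u uk} km wk.
have [N] := ubnP (\sum_i k i ^ 2); elim: N k w => // N IHN k w Nk km wk.
(* Exponents on [sl] exceed those off it by at least v + 1, hence by 2, as [sum_squares_lt]
   demands. *)
have [sl [us sk nsk]] := greedy_chain k m v.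
have sn : (size sl <= n)%N.
  by have := uniq_leq_size us (fun j _ => mem_enum 'I_n j); rewrite size_enum_ord.
apply: (common_factor (J := [set: 'I_(n * v).+1]) (d := k) (s := sl) (y := y) us _ _
  (br_mul_multisubspace (fun i => x ^+ (m - k i)) sT)) => // [|p i0 ps|].
- by rewrite cardsT card_ord ltnS leq_mul2r sn orbT.
- have := sk p i0 ps.
  have : ((size sl - p.+1) * v + p * v <= n.-1 * v)%N.
    rewrite -mulnDl leq_mul2r; apply/orP; right.
    by move: sn ps; move: (size sl) => q; lia.
  by lia.
move=> j w0 _ w0k.
pose s : {set 'I_n} := [set i in sl].
pose mu := curve ioP y j.
have Lmu : L mu by apply/yL/curve_lin.
pose k0 i := (k i - (i \in s))%N.
pose w1 i := if i \in s then w0 i else w i.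
have ks i : i \in s -> (0 < k i)%N.
  rewrite inE => isl; have := sk (index i sl) i; rewrite index_mem nth_index //.
  move/(_ isl); have : (index i sl * v <= n.-1 * v)%N.
    rewrite leq_mul2r; apply/orP; right; move: isl sn; rewrite -index_mem.
    by move: (size sl) (index i sl) => q p; lia.
  by lia.
have m0 : (0 < m)%N by lia.
have kns i : i \notin s -> (k i < m)%N.
  by rewrite inE => /nsk; lia.
have k0m i : (k0 i < m)%N.
  rewrite /k0; case si: (i \in s); last by rewrite subn0 kns ?si.
  by have := ks i si; have := km i; lia.
have w1k i : hom ioP (lin ioP y) (k0 i) (w1 i).
  rewrite /k0 /w1; case si: (i \in s); last by rewrite subn0.
  by rewrite subn1; apply: w0k; move: si; rewrite inE.
pose l i := if i \in s then mu else x.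
pose z i := x ^+ (m.-1 - k0 i) * w1 i.
have Tlz : T (br l * br z).
  apply: TL => i; first by rewrite /l; case: ifP.
  rewrite /z; have -> : m.-1 = (m.-1 - k0 i + k0 i)%N by have := k0m i; lia.
  rewrite addnK; apply: homM; first exact: homX.
  exact: hom_mono yL (w1k i).
pose A := [set t : 'S_n | t @^-1: s == s].
have lz (t : 'S_n) i : l (t i) * z i =
    x ^+ (m - (k0 i + (t i \in s))) * ((if t i \in s then mu else 1) * w1 i).
  rewrite /l /z; case: (t i \in s).
    by rewrite mulrCA; congr (x ^+ _ * _); lia.
  rewrite addn0 mul1r mulrA -exprS; congr (x ^+ _ * _).
  by have := k0m i; lia.
move: Tlz; rewrite brM (bigID (mem A)) /=.
set tgt := br (fun i => _); have -> : \sum_(t in A) br (fun i => l (t i) * z i) =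
    tgt *+ #|A|.
  rewrite -sumr_const; apply: eq_bigr => t; rewrite inE => /eqP ts.
  congr br; apply: funext => i.
  have tis : (t i \in s) = (i \in s) by rewrite -[in RHS]ts [RHS]in_set.
  rewrite lz tis /k0 /w1.
  rewrite (_ : (i \in sl) = (i \in s)); last by rewrite inE.
  case si: (i \in s); last by rewrite subn0 addn0 mul1r.
  by rewrite subnK //; apply: ks.
have Trest : T (\sum_(t | t \notin A) br (fun i => l (t i) * z i)).
  apply: (subspace_sum (io := io)) => // t; rewrite inE => ts.
  rewrite (_ : (fun i => l (t i) * z i) = fun i => x ^+ (m - (k0 i + (t i \in s))) *
    ((if t i \in s then mu else 1) * w1 i)); last by apply: funext => i.
  apply: IHN => [|i|i].
  - rewrite -ltnS; apply: leq_trans Nk; rewrite ltnS.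
    apply: sum_squares_lt ts => i i'; rewrite !inE => isl /nsk.
    have := sk (index i sl) i; rewrite index_mem nth_index // => /(_ isl).
    have : (index i sl * v + v <= size sl * v)%N.
      by rewrite addnC -mulSn leq_mul2r index_mem isl orbT.
    by lia.
  - by have := k0m i; case: (t i \in s) => /=; lia.
  - case: (t i \in s); last by rewrite addn0 mul1r.
    by rewrite addn1; apply: homS => //; apply: curve_lin.
move=> /(subspace_addKr sT Trest) TA; apply: (subspace_natmul sT _ TA).
apply/card_gt0P; exists 1%g; rewrite inE; apply/eqP/setP => i.
by rewrite inE perm1.
Qed.
End Generation.

(** * Generation by brackets in at least three variables *)

Section BracketsGenerate.
Variables (K : numClosedFieldType) (Q : comPzRingType) (io : {rmorphism K -> Q}).
Variables (n : nat).
Local Notation P := {ffun 'I_n -> Q}.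
Local Notation ioP := (ffun_const io 'I_n).
Implicit Types (x z : P) (u l : 'I_n -> P).
Local Notation B L := (hom io (brs L)).

(** Beyond degree (n-1)v, [br_generated] splits off a bracket of degree one; hence the exponent [c]
    that suffices up to m = (n-1)v suffices for every [m]. *)
Lemma lin_conductor (v : nat) (y : 'I_v.+2 -> P) x m u : (0 < v)%N ->
  lin ioP y x -> (forall i, hom ioP (lin ioP y) m (u i)) ->
  let c := (n.-1 * (n.-1 * v))%N in
  B (lin ioP y) (c + m) (nrm x ^+ c * br u).
Proof.
move=> v0 yx + c; elim: m u => [|m IHm] u um.
  by apply: B_conductor um; rewrite ?muln0 //; apply: lin_subspace.
have [mv|mv] := leqP m.+1 (n.-1 * v).
  by apply: B_conductor um; rewrite ?leq_mul2l ?mv ?orbT //; apply: lin_subspace.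
pose y' a := y (lift ord0 a).
have y'y z : lin ioP y' z -> lin ioP y z.
  by apply: lin_sub => [|a]; [apply: lin_subspace | apply: lin_gen].
apply: (@br_generated _ _ _ _ v y' (y ord0) (lin ioP y) m.+1
  (fun q => B (lin ioP y) (c + m.+1) (nrm x ^+ c * q))) => //.
- exact: lin_gen.
- exact: y'y.
- move=> _ [a ->]; exists (a ord0); exists (fun i => a (lift ord0 i)).
  by rewrite big_ord_recl addrAC subrr add0r.
- exact/subspaceMl/hom_subspace.
move=> l w yl wm; rewrite mulrCA addnS -(add1n (c + m)); apply: homM; last exact: IHm.
by apply: hom_gen; exists l.
Qed.

Lemma brackets_generate (v : nat) (y : 'I_v.+2 -> P) d u : (0 < v)%N ->
  (n.-1 * v.+1 + (n * v.+1).+1 * (n.-1 * (n.-1 * v)) <= d)%N ->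
  (forall i, hom ioP (lin ioP y) d (u i)) -> B (lin ioP y) d (br u).
Proof.
move=> v0 hd ud; pose r := (n * v.+1).+1; set c := (n.-1 * (n.-1 * v))%N in hd.
pose N (j : 'I_r) := nrm (curve ioP y j).
have yN j k : B (lin ioP y) k (N j ^+ k) by apply/B_nrmX/curve_lin.
have sB := hom_subspace io (brs (lin ioP y)) d.
(* [a j] counts the norms [N j] already split off, and [m] is the degree left. *)
suff H m (a : 'I_r -> nat) (w : 'I_n -> P) : (\sum_j a j + m = d)%N ->
    (forall i, hom ioP (lin ioP y) m (w i)) ->
    B (lin ioP y) d ((\prod_(j < r) N j ^+ a j) * br w).
  have := H d (fun=> 0%N) u; rewrite big1 // big1 ?mul1r //; exact.
elim/ltn_ind: m a w => m IHm a w ad wm.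
have [/existsP[j caj]|/existsPn ac] := boolP [exists j, (c <= a j)%N].
  have -> : \prod_i N i ^+ a i * br w =
      (\prod_(i | i != j) N i ^+ a i * N j ^+ (a j - c)) *
      (N j ^+ c * br w).
    by rewrite (bigD1 j) //= -{1}(subnK caj) exprD; ring.
  have -> : d = (\sum_(i | i != j) a i + (a j - c) + (c + m))%N.
    by rewrite -ad (bigD1 j) //=; lia.
  apply: homM; last exact/lin_conductor/wm/curve_lin.
  apply: homM; last exact: yN.
  apply: (big_rec2 (fun q k => B (lin ioP y) k q)); first exact: hom1.
  by move=> i k q _ kq; apply: homM.
(* With every [a j] below [c], their sum is below [r * c]; the degree left is then large enough to
   split off another norm. *)
have am : (n.-1 * v.+1 < m)%N.
  have : (\sum_j a j < r * c)%N.
    have : (\sum_j (a j).+1 <= r * c)%N.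
      rewrite -[r in (r * _)%N]card_ord -sum_nat_const; apply: leq_sum => j _.
      by rewrite ltnNge ac.
    under eq_bigr => j _ do rewrite -addn1.
    by rewrite big_split /= sum_nat_const card_ord muln1 /r addnS; lia.
  have : (n.-1 * v.+1 + r * c <= d)%N by [].
  rewrite -ad; move: (n.-1 * v.+1)%N (r * c)%N (\sum_j a j)%N => A B C; lia.
have sG : multisubspace ioP (fun w => B (lin ioP y) d
    (\prod_(j < r) N j ^+ a j * br w)).
  exact: br_multisubspace (subspaceMl _ sB).
apply: (common_factor (J := [set: 'I_r]) (d := fun=> m) (s := enum 'I_n)
  (y := y) (enum_uniq _) _ _ sG) => [|p i0|j w' _ w'm|//].
- by rewrite cardsT card_ord size_enum_ord.
- rewrite size_enum_ord => pn; apply: leq_ltn_trans am.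
  by rewrite leq_mul2r; lia.
rewrite (_ : (fun i => _) = fun i => curve ioP y j * w' i); last first.
  by apply: funext => i; rewrite mem_enum.
rewrite br_mull -/(N j) mulrA.
have -> : \prod_j0 N j0 ^+ a j0 * N j =
  \prod_i N i ^+ (a i + (i == j)).
  under [RHS]eq_bigr => i _ do rewrite exprD.
  rewrite [RHS]big_split; congr (_ * _).
  rewrite [RHS](bigD1 j) //= eqxx expr1 big1 ?mulr1 // => i /negbTE ->.
  by rewrite expr0.
apply: (IHm m.-1); rewrite ?prednK //; first by lia.
  rewrite big_split /= [X in (_ + X + _)%N](bigD1 j) //= eqxx.
  rewrite [X in (_ + (_ + X) + _)%N]big1 => [|i /negbTE -> //].
  by rewrite addn0 -addnA add1n prednK ?ad //; apply: leq_ltn_trans am.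
by move=> i; apply: w'm; rewrite mem_enum.
Qed.
End BracketsGenerate.

(** * Two variables at most, and reduction to at most [n] forms *)

Section BracketsGenerateMin.
Variables (K : numClosedFieldType) (Q : comPzRingType) (io : {rmorphism K -> Q}).
Variables (n : nat).
Local Notation P := {ffun 'I_n -> Q}.
Local Notation ioP := (ffun_const io 'I_n).
Implicit Types (u : 'I_n -> P).
Local Notation B L := (hom io (brs L)).

Lemma lin_pencil (w : nat) (y : 'I_w -> P) : (w <= 2)%N ->
  exists x1 x2, forall z, lin ioP y z <-> pencil io x1 x2 z.
Proof.
case: w y => [|[|[|//]]] y _.
- exists 0, 0 => z; split=> [[c ->]|[a [b ->]]].
    by exists 0, 0; rewrite big_ord0 !mulr0 addr0.
  by exists (fun=> 0); rewrite big_ord0 !mulr0 addr0.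
- exists (y ord0), 0 => z; split=> [[c ->]|[a [b ->]]].
    by exists (c ord0), 0; rewrite big_ord_recl big_ord0 mulr0.
  by exists (fun=> a); rewrite big_ord_recl big_ord0 mulr0.
exists (y ord0), (y (lift ord0 ord0)) => z; split=> [[c ->]|[a [b ->]]].
  by exists (c ord0), (c (lift ord0 ord0)); rewrite !big_ord_recl big_ord0 addr0.
exists (fun i => if i == ord0 then a else b).
by rewrite !big_ord_recl big_ord0 addr0.
Qed.

(* With r = n(w-1)+1 points of the curve and c = (n-1)^2(w-2): as long as the
   remaining degree exceeds (n-1)(w-1), one of the r norms can be split off, and
   once a norm occurs c times, everything is generated by brackets. *)
Definition enough (w d : nat) : bool :=
  (w <= 2)%N ||
  (n.-1 * w.-1 + (n * w.-1).+1 * (n.-1 * (n.-1 * w.-2)) <= d)%N.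

Lemma B_enough (w : nat) (y : 'I_w -> P) d u : enough w d ->
  (forall i, hom ioP (lin ioP y) d (u i)) -> B (lin ioP y) d (br u).
Proof.
have [w2 _ uy|] := leqP w 2.
  have [x1 [x2 yx]] := lin_pencil y w2.
  apply: (@br_pencil _ _ _ _ _ x1 x2) => [z /yx //|i].
  by apply: hom_mono (uy i) => z /yx.
rewrite /enough; case: w y => [|[|[|v]]] y //= _.
exact: brackets_generate.
Qed.

(* Powers of n linear forms only involve a space of at most n linear forms. *)
Lemma B_enough_min (w : nat) (y : 'I_w -> P) d u : enough (minn n w) d ->
  (forall i, hom ioP (lin ioP y) d (u i)) -> B (lin ioP y) d (br u).
Proof.
have [_|_] := leqP n w; last exact: B_enough.
move=> nd uy; apply: (br_hom_powers _ (hom_subspace _ _ _) _ uy).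
  exact: lin_subspace.
move=> l ly; have : B (lin ioP l) d (br (fun i => l i ^+ d)).
  by apply: B_enough nd _ => i; apply/homX/lin_gen.
apply: hom_mono => _ [b lb ->]; exists b => // i.
exact: lin_sub (lin_subspace _ _) ly _ (lb i).
Qed.

End BracketsGenerateMin.

(** * Numerical estimates *)

(** Induction by the ratio (n + k + 1) / (k + 1) of consecutive binomials, which suffices from k = 3
    on; the cases 2 and 3 are computed directly. *)
Lemma bin_ge_le (n k : nat) : (1 < k)%N -> (k < n)%N ->
  (k.+1 * (n * k.-1) <= 'C(n + k, k))%N.
Proof.
elim: k => // k IHk; rewrite ltnS leq_eqVlt => /predU1P[<-|k1] kn.
  rewrite -(@leq_pmul2l 2) //.
  have := mul_bin_diag (n + 2) 1; have := mul_bin_diag (n + 2).-1 0.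
  rewrite bin0; nia.
have [k2|k3] := leqP k 2.
  have k2' : k = 2%N by lia.
  subst k.
  have := mul_bin_diag (n + 3) 2; have := mul_bin_diag (n + 3).-1 1.
  have := mul_bin_diag (n + 3).-2 0.
  rewrite bin0; nia.
have {}IHk := IHk k1 (ltnW kn).
have := mul_bin_diag (n + k.+1) k; rewrite addnS /= => E.
rewrite -(@leq_pmul2l k.+1) // -E.
apply: leq_trans (leq_mul (leqnn _) IHk).
move: kn k3; case: k {IHk E k1} => // k kn k3 /=.
have : (k.+3 * k.+1 <= (n + k.+2) * k)%N by nia.
nia.
Qed.

(** Starts from [bin_ge_le] at k = n - 1; a step multiplies the binomial by (n + k + 1) / (k + 1),
    the left side only by (k + 2) / (k + 1). *)
Lemma bin_ge_ge (n k : nat) : (2 < n)%N -> (n <= k.+1)%N ->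
  (k.+1 * (n * n.-2) <= 'C(n + k, k))%N.
Proof.
move=> n2; elim: k => [|k IHk]; first by lia.
rewrite leq_eqVlt => /predU1P[nk|].
  by have := @bin_ge_le n k.+1; rewrite nk; apply; lia.
rewrite ltnS => /IHk {}IHk.
have := mul_bin_diag (n + k.+1) k; rewrite addnS /= => E.
rewrite -(@leq_pmul2l k.+1) // -E.
apply: leq_trans (leq_mul (leqnn _) IHk).
move: (n * n.-2)%N => c; nia.
Qed.

(** [s] stands for the ceiling. For m = min(n, w) > 2 the binomial estimates give s >= n(m - 2). *)
Lemma enough_bound (n w d : nat) (s : int) : (0 < n)%N -> (0 < w)%N ->
  ('C(n + w - 1, w - 1)%:Z <= w%:Z * s) ->
  ((n%:Z - 1) * (w%:Z - 1) * ((n%:Z - 1) * s + n%:Z) <= d%:Z) ->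
  enough n (minn n w) d.
Proof.
move=> n0 w0 hC hd; rewrite /enough; have [//|m2] := leqP (minn n w) 2.
have n2 : (2 < n)%N by lia.
have w2 : (2 < w)%N by lia.
rewrite /=; set m := minn n w in m2 *.
have hs : (n * m.-2)%:Z <= s.
  have : (w * (n * m.-2) <= 'C(n + w - 1, w - 1))%N.
    case: w w0 w2 @m {hC hd} m2 => // k _ k2 m m2.
    rewrite addnS subn1 subn1 /=; rewrite /m; case: (leqP n k.+1) => nk.
      by apply: bin_ge_ge.
    by apply: bin_ge_le; lia.
  rewrite -lez_nat PoszM => h; have := le_trans h hC.
  by rewrite ler_pM2l.
have mw : (m.-2 + 2 <= w)%N by rewrite addn2 /m; lia.
have -> : m.-1 = m.-2.+1 by lia.
move: m.-2 hs mw => v hs vw.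
have {}hd : (n%:Z - 1) * (v%:Z + 1) * ((n%:Z - 1) * (n * v)%:Z + n%:Z) <= d%:Z.
  have n1 : 0 <= n%:Z - 1 by lia.
  have nv : 0 <= (n%:Z - 1) * (n * v)%:Z by apply: mulr_ge0.
  apply: le_trans hd; apply: ler_pM.
  - by apply: mulr_ge0 => //; lia.
  - by lia.
  - by apply: ler_wpM2l => //; lia.
  - by rewrite lerD2r; apply: ler_wpM2l.
(* With n = N + 1, the bound known for [d] exceeds the one wanted by N^2. *)
case: n n0 hd {n2 hs hC m m2} => // N _ hd /=.
rewrite -lez_nat; apply: le_trans hd; rewrite !(PoszD, PoszM, intS).
have : 0 <= N%:Z * N%:Z * v%:Z * 1 by rewrite !mulr_ge0.
nia.
Qed.

(** * Spanning symmetric powers by powers and products of powers *)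

Section Combination.
Variables (K : numFieldType) (A : Type) (V : lmodType K) (F : A -> V).

(** An explicit list, as its coefficients and generators become the data [c] and [X] of the duality
    argument. *)
Definition combination (x : V) :=
  exists s : seq (K * A), x = \sum_(p <- s) p.1 *: F p.2.

Lemma combination_sum (I : Type) (r : seq I) (P : pred I) (c : I -> K) (f : I -> V) :
  (forall i, P i -> combination (f i)) ->
  combination (\sum_(i <- r | P i) c i *: f i).
Proof.
move=> Ff; apply: big_ind => [|_ _ [s ->] [t ->]|i /Ff[s ->]].
- by exists [::]; rewrite big_nil.
- by exists (s ++ t); rewrite big_cat.
- exists [seq (c i * p.1, p.2) | p <- s]; rewrite big_map scaler_sumr.
  by apply: eq_bigr => p _; rewrite scalerA.
Qed.
End Combination.

Section SympowSpan.
Variable K : numFieldType.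
Implicit Types (V W : vectType K).

Lemma tpow_expand (I : finType) V (t : tpow I V) :
  t = \sum_f tcoef t f *: tprod (tbasis f).
Proof.
have := @tprod_ext K I V (tpow I V) idfun (tlift (@tprod K I V)).
by apply=> v /=; rewrite tlift_tprod //; apply: tprod_multilinear.
Qed.

Lemma sympow_expand d V (s : sympow d V) :
  s = \sum_f tcoef (vsval s) f *: symproj (tprod (tbasis f)).
Proof.
transitivity (symproj (vsval s)).
  by rewrite /symproj symmetrize_id ?vsvalK // subvsP.
rewrite [in LHS](tpow_expand (vsval s)) linear_sum; apply: eq_bigr => f _.
by rewrite linearZ.
Qed.

Lemma tprod_polarization d V (v : {ffun 'I_d -> V}) :
  \sum_(s : 'S_d) tact s (tprod v) =
  \sum_(S : {set 'I_d}) (-1) ^+ #|~: S| *: tprod [ffun=> \sum_(j in S) v j].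
Proof.
apply/ffunP => f; rewrite !sum_ffunE.
under eq_bigr => s _ do rewrite tact_tprod ffunE.
under [RHS]eq_bigr => S _ do rewrite !ffunE.
pose u j i := coord (vbasis {:V}) (f i) (v j).
transitivity (\sum_(s : 'S_d) \prod_i u (s i) i).
  by apply: eq_bigr => s _; apply: eq_bigr => i _; rewrite ffunE.
rewrite ryser; apply: eq_bigr => S _; congr (_ * _); apply: eq_bigr => i _.
by rewrite ffunE linear_sum.
Qed.

(** Polarization in characteristic 0: a symmetrized basis tensor is a combination of d-th powers. *)
Lemma sympow_powers d V (s : sympow d V) :
  combination (fun x : V => symproj (tprod [ffun=> x]) : sympow d V) s.
Proof.
rewrite (sympow_expand s); apply: combination_sum => f _.
set v := tbasis f.
have -> : symproj (tprod v) = (d`!%:R)^-1 *: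
    \sum_(S : {set 'I_d}) (-1) ^+ #|~: S| *: symproj (tprod [ffun=> \sum_(j in S) v j]).
  apply: (scalerI (a := d`!%:R)); first by rewrite pnatr_eq0 -lt0n fact_gt0.
  rewrite scalerA divff ?scale1r; last by rewrite pnatr_eq0 -lt0n fact_gt0.
  transitivity (symproj (\sum_(s : 'S_d) tact s (tprod v))).
    rewrite linear_sum /=; under eq_bigr => t _ do rewrite symproj_act.
    by rewrite sumr_const card_Sn scaler_nat.
  rewrite tprod_polarization linear_sum; apply: eq_bigr => S _.
  by rewrite linearZ.
rewrite scaler_sumr; under eq_bigr => S _ do rewrite scalerA.
apply: combination_sum => S _; exists [:: (1, \sum_(j in S) v j)].
by rewrite big_seq1 scale1r.
Qed.

Lemma tprod_sum (I J : finType) V (c : I -> J -> K) (b : I -> J -> V) :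
  tprod [ffun i => \sum_j c i j *: b i j] =
  \sum_(f : {ffun I -> J}) (\prod_i c i (f i)) *: tprod [ffun i => b i (f i)].
Proof.
apply/ffunP => g; rewrite sum_ffunE ffunE.
under eq_bigr => i _ do rewrite ffunE linear_sum.
rewrite bigA_distr_bigA; apply: eq_bigr => f _; rewrite !ffunE.
rewrite -[RHS]/(_ * _) -big_split; apply: eq_bigr => i _.
by rewrite linearZ ffunE.
Qed.

Definition power_product n d W (X : {ffun 'I_n -> W}) : sympow n (sympow d W) :=
  symproj (tprod [ffun i => symproj (tprod [ffun=> X i])]).

(** [sympow_powers] is used twice: for n-th powers of elements [a] of S^d W, then for [a] itself. *)
Lemma sympow_power_products n d W (x : sympow n (sympow d W)) :
  combination (@power_product n d W) x.
Proof.
have [s ->] := sympow_powers x.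
apply: combination_sum => [[c a]] _ /=.
have [r ->] := sympow_powers a.
rewrite big_tnth.
rewrite (_ : [ffun=> _] = [ffun i : 'I_n => \sum_(j < size r)
  (tnth (in_tuple r) j).1 *: symproj (tprod [ffun=> (tnth (in_tuple r) j).2])]) //.
rewrite tprod_sum linear_sum /=.
under eq_bigr => f _ do rewrite linearZ /=.
apply: combination_sum => f _.
exists [:: (1, [ffun i => (tnth (in_tuple r) (f i)).2])].
rewrite big_seq1 scale1r /power_product; congr (symproj (tprod _)).
by apply/ffunP => i; rewrite !ffunE; congr (symproj (tprod _)).
Qed.
End SympowSpan.

(** * Duality between brackets and the kernel *)

Lemma prod_multilinear (K : fieldType) (I : finType) (V : vectType K)
    (g : I -> {linear V -> K^o}) :
  multilinear (fun v : {ffun I -> V} => \prod_i g i (v i) : K^o).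
Proof.
move=> v i a x y; rewrite (bigD1 i) //= [X in _ = _ *: X + _](bigD1 i) //=.
rewrite [X in _ = _ + X](bigD1 i) //= !ffunE eqxx linearP /=.
have E z : \prod_(j | j != i) g j (upd v i z j) = \prod_(j | j != i) g j (v j).
  by apply: eq_bigr => j /negbTE ji; rewrite ffunE ji.
by rewrite !E mulrDl -scalerAl.
Qed.

Section Transfer.
Variables (K : numFieldType) (W : vectType K) (n d M : nat).
Variables (c : 'I_M -> K) (X : 'I_M -> {ffun 'I_n -> W}).
Local Notation Q := {ffun 'I_M -> K}.
Local Notation P := {ffun 'I_n -> Q}.

Definition const_fun := ffun_const (idfun : {rmorphism K -> K}) 'I_M.
Local Notation ioP := (ffun_const const_fun 'I_n).

(** A polynomial is represented by its values on the finitely many tuples [X k] of one linear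
    relation; the abstract ring [Q] becomes the functions on ['I_M]. *)
Definition pointval (g : W -> K) : P := [ffun i => [ffun k => g (X k i)]].

Definition pairing (q : Q) : K := \sum_k c k * q k.

Lemma pairing_subspace : subspace const_fun (fun q => pairing q = 0).
Proof.
split=> [|p q p0 q0|a q q0]; rewrite /pairing.
- by rewrite big1 // => k _; rewrite ffunE mulr0.
- under eq_bigr => k _ do rewrite ffunE mulrDr.
  by rewrite big_split /= -/(pairing p) -/(pairing q) p0 q0 addr0.
- under eq_bigr => k _ do rewrite !ffunE mulrCA.
  by rewrite -mulr_sumr -/(pairing q) q0 mulr0.
Qed.

Lemma br_pointval (g : 'I_n -> W -> K) k :
  br (fun i => pointval (g i)) k = \sum_(s : 'S_n) \prod_i g i (X k (s i)).
Proof.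
rewrite sum_ffunE [RHS](reindex_inj invg_inj) /=; apply: eq_bigr => s _.
rewrite [RHS](reindex_inj (@perm_inj _ s)) prod_ffunE; apply: eq_bigr => i _.
by rewrite !ffunE permK.
Qed.

Definition coordval (a : 'I_(\dim {:W})) : P := pointval (coord (vbasis {:W}) a).

Lemma lin_pointval (b : 'I_n -> P) : (forall i, lin ioP coordval (b i)) ->
  exists g : 'I_n -> {linear W -> K^o}, forall i, b i = pointval (g i).
Proof.
move=> /fin_all_exists[C bC].
have gl i : linear (fun v => \sum_a C i a * coord (vbasis {:W}) a v : K^o).
  move=> e u v; rewrite scaler_sumr -big_split; apply: eq_bigr => a _.
  by rewrite linearP mulrDr /= -[in RHS]/(_ * _) mulrCA.
pose p i := GRing.isLinear.Build _ _ _ _ _ (gl i).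
pose G i : {linear W -> K^o} :=
  HB.pack (fun v => \sum_a C i a * coord (vbasis {:W}) a v : K^o) (p i).
exists G => i; rewrite bC; apply/ffunP => j; apply/ffunP => k.
rewrite !ffunE !sum_ffunE; apply: eq_bigr => a _.
by rewrite !ffunE.
Qed.

Hypothesis FH0 :
  \sum_k c k *: foulkes_howe (power_product d (X k)) = 0.

(** A product of [d] brackets of linear forms is, up to the factor n!^d, a linear functional on
    S^d(S^n W) evaluated at (x_1 ... x_n)^d, the image of a power product. *)
Lemma pairing_B q : hom const_fun (brs (lin ioP coordval)) d q -> pairing q = 0.
Proof.
apply: (span_sub (T := fun q => pairing q = 0)); first exact: pairing_subspace.
move=> _ [l lB ->].
have [b bl lb] := fin_all_exists2 lB.
have [g bg] := fin_all_exists (fun j => lin_pointval (bl j)).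
pose th j : {linear tpow 'I_n W -> K^o} :=
  tlift (fun v : {ffun 'I_n -> W} => \prod_i g j i (v i) : K^o).
pose th' j : {linear sympow n W -> K^o} := th j \o vsval.
pose M' : {linear tpow 'I_d (sympow n W) -> K^o} :=
  tlift (fun v : {ffun 'I_d -> sympow n W} => \prod_j th' j (v j) : K^o).
have th'E j k : th' j (symproj (tprod (X k))) = (n`!%:R)^-1 * l j k.
  rewrite /th' /= vsval_symproj /symmetrize linearZ linear_sum /=.
  congr (_ * _); rewrite lb (_ : b j = fun i => pointval (g j i)); last exact/funext.
  rewrite br_pointval; apply: eq_bigr => s _.
  rewrite tact_tprod tlift_tprod; last exact: prod_multilinear.
  by apply: eq_bigr => i _; rewrite ffunE.
pose F : {linear sympow d (sympow n W) -> K^o} := M' \o vsval.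
have FE k : F (foulkes_howe (power_product d (X k))) =
    (n`!%:R)^-1 ^+ d * (\prod_j l j) k.
  rewrite foulkes_howe_powers /F /= symproj_const tlift_tprod; last first.
    exact: (prod_multilinear th').
  rewrite prod_ffunE -[X in _ ^+ X]card_ord -prodr_const -big_split.
  by apply: eq_bigr => j _; rewrite ffunE; apply: th'E.
have : F (\sum_k c k *: foulkes_howe (power_product d (X k))) = 0.
  by rewrite FH0 linear0.
have FZ a z : F (a *: z) = a * F z.
  exact: linearZ_LR.
rewrite linear_sum (eq_bigr (fun k => (n`!%:R)^-1 ^+ d * (c k * (\prod_j l j) k))).
  rewrite -mulr_sumr => /eqP; rewrite mulf_eq0 expf_eq0 invr_eq0 pnatr_eq0.
  by rewrite eqn0Ngt fact_gt0 andbF => /eqP.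
by move=> k _; rewrite FZ FE mulrCA.
Qed.

(** Expanding v^d in basis tensors produces monomials in the coordinates of [v]. *)
Lemma coord_pointval_hom (z : {linear sympow d W -> K^o}) :
  hom ioP (lin ioP coordval) d
    (pointval (fun v => z (symproj (tprod [ffun=> v])))).
Proof.
have -> : pointval (fun v => z (symproj (tprod [ffun=> v]))) =
  \sum_f ioP (z (symproj (tprod (tbasis f)))) * \prod_(j < d) coordval (f j).
  apply/ffunP => i; apply/ffunP => k; rewrite !ffunE sum_ffunE sum_ffunE.
  rewrite [in LHS](tpow_expand (tprod _)) !linear_sum; apply: eq_bigr => f _.
  rewrite !linearZ /= !ffunE mulrC; congr (_ * _).
  rewrite prod_ffunE prod_ffunE /tcoef ffunE; apply: eq_bigr => j _.
  by rewrite !ffunE.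
apply: (subspace_sum (io := ioP)) => [|f _]; first exact: hom_subspace.
apply: spanZ; apply: span_gen; exists (fun j => coordval (f j)) => // j.
exact: lin_gen.
Qed.

Hypothesis brB : forall u, (forall i, hom ioP (lin ioP coordval) d (u i)) ->
  hom const_fun (brs (lin ioP coordval)) d (br u).

(** The coordinate at [f] of a power product is [br u] divided by n!, where [u i] is the coordinate
    [f i] of a d-th power; [brB] and [pairing_B] then apply. *)
Lemma combination_eq0 : \sum_k c k *: power_product d (X k) = 0.
Proof.
apply: subvs_inj; rewrite linear_sum linear0 /=.
apply/ffunP => f; rewrite sum_ffunE ffunE.
pose u i := pointval (fun v =>
  coord (vbasis {: sympow d W}) (f i) (symproj (tprod [ffun=> v]))).
have := pairing_B (brB (u := u) (fun i => coord_pointval_hom _)).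
rewrite /pairing => E.
transitivity ((n`!%:R)^-1 * \sum_k c k * br u k); last by rewrite E mulr0.
rewrite mulr_sumr; apply: eq_bigr => k _.
rewrite /power_product vsval_symproj /symmetrize br_pointval !ffunE sum_ffunE.
rewrite -[LHS]/(c k * (_ * _)) mulrCA; congr (_ * (_ * _)).
apply: eq_bigr => s _; rewrite tact_tprod ffunE; apply: eq_bigr => i _.
by rewrite !ffunE.
Qed.
End Transfer.

(** * Injectivity *)

Lemma foulkes_howe_inj (K : numClosedFieldType) (W : vectType K) (n d : nat) :
  enough n (minn n (\dim {:W})) d -> injective (@foulkes_howe K n d W).
Proof.
move=> nd; suff FH0 (z : sympow n (sympow d W)) : foulkes_howe z = 0 -> z = 0.
  by move=> x y xy; apply/subr0_eq/FH0; rewrite linearB /= xy subrr.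
have [s ->] := sympow_power_products z; rewrite big_tnth linear_sum => FHz.
pose c k := (tnth (in_tuple s) k).1; pose X k := (tnth (in_tuple s) k).2.
apply: (@combination_eq0 K W n d (size s) c X) => [|u uB]; last exact: B_enough_min.
by rewrite -[RHS]FHz; apply: eq_bigr => k _; rewrite linearZ.
Qed.

Theorem corollary1p11 (R : realType) (W : vectType R[i]) (w d delta : nat)
    (hW : \dim {:W} = w) (hw : (1 <= w)%N) (hd : (0 < d)%N)
    (hdelta : (0 < delta)%N)
    (hbound : (delta%:Z - 1) * (w%:Z - 1) *
        ((delta%:Z - 1) *
           Num.ceil (('C(delta + w - 1, w - 1))%:R / w%:R : rat) + delta%:Z)
        <= d%:Z) :
  injective (@foulkes_howe R[i] delta d W).
Proof.
apply: foulkes_howe_inj; rewrite hW; apply: enough_bound hbound => //.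
(* The ceiling enters through [ceil_ge]: multiplied by [w], it is at least the binomial. *)
set q : rat := _ / _.
have w0 : (0 : rat) < w%:R by rewrite ltr0n.
rewrite -(ler_int rat) intrM mulrC -ler_pdivrMr //.
exact: ceil_ge.
Qed.
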